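(* Let $r\ge1$. The action of $\mathcal J(A)$ on $\mathcal L^{\le r}$ given by $J(\Lambda)=J^{-1}\Lambda$ is by homeomorphisms: for each $J\in\mathcal J(A)$ the map $\mathcal L^{\le r}\to\mathcal L^{\le r}$, $\Lambda\mapsto J^{-1}\Lambda$, is a homeomorphism for the topology induced by $\mathrm d_{\mathcal L}$.
   Context: $F$ is a global function field of prime characteristic with field of constants $\mathbb F_q$; $\infty$ is a fixed place of $F$ of degree $\delta$; $A\subset F$ is the ring of elements regular away from $\infty$; $|\cdot|$ is the absolute value at $\infty$ with $|\pi|=q^{-\delta}$ for a uniformiser $\pi$; $F_\infty$ is the completion of $F$, and $\mathbb C_\infty$ is the completion of an algebraic closure of $F_\infty$. $\mathcal J(A)$ is the group of nonzero fractional ideals of $A$ in $F$. A lattice is a finitely generated $A$-submodule $\Lambda\subset\mathbb C_\infty$ meeting every ball of finite radius in a finite set; its rank is its rank as a projective $A$-module. $\mathcal L^{\le r}$ is the set of lattices of rank $\le r$ (including the zero lattice), with metric $\mathrm d_{\mathcal L}(\Lambda_1,\Lambda_2)=\sup_{|z|\le1}|e_{\Lambda_1}(z)-e_{\Lambda_2}(z)|$, where $e_\Lambda(z)=z\prod_{0\ne\lambda\in\Lambda}(1-z/\lambda)$. *)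

(* Defs.v *)
(* MathComp / MathComp-Analysis. *)
From HB Require Import structures.
From mathcomp Require Import all_boot all_order all_algebra all_field.
From mathcomp Require Import finmap.
From mathcomp Require Import all_classical all_reals all_analysis.

Set Implicit Arguments.
Unset Strict Implicit.
Unset Printing Implicit Defensive.

Import Order.TTheory GRing.Theory Num.Theory.
Import numFieldNormedType.Exports.

Local Open Scope classical_set_scope.
Local Open Scope ring_scope.

(* A global function field with constants in the finite field k is a finite
   extension F of the rational function field k(t) = {fraction {poly k}}. *)

Definition constF (k : finFieldType) (F : fieldExtType {fraction {poly k}})
  (c : k) : F := (@FracField.tofrac {poly k} c%:P)%:A.

Definition is_constant_field (k : finFieldType)
    (F : fieldExtType {fraction {poly k}}) : Prop :=
  forall x : F, algebraicOver (@constF k F) x -> exists c : k, x = constF F c.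

(* Places are given by their normalised discrete valuations. The valuation of
   0 should be +oo; the value 0 recorded by [place_val0] is a placeholder that
   makes the function determined by the place. Triviality on the constants is
   automatic, since these form a finite field. *)
Record place (F : fieldType) := Place {
  place_val :> F -> int;
  place_val0 : place_val 0 = 0;
  place_valM : forall x y, x != 0 -> y != 0 ->
    place_val (x * y) = place_val x + place_val y;
  place_valD : forall x y, x != 0 -> y != 0 -> x + y != 0 ->
    Order.min (place_val x) (place_val y) <= place_val (x + y);
  place_val_uniformiser : exists2 x, x != 0 & place_val x = 1
}.

Definition place_ring (F : fieldType) (v : place F) : set F :=
  [set x | x = 0 \/ 0 <= v x].

Definition place_ideal (F : fieldType) (v : place F) : set F :=
  [set x | x = 0 \/ 0 < v x].

(* [b] reduces to a basis over the constants of the residue field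
   [place_ring v / place_ideal v]. *)
Definition residue_basis (k : finFieldType)
    (F : fieldExtType {fraction {poly k}}) (v : place F) (d : nat)
    (b : 'I_d -> F) : Prop :=
  [/\ forall i, place_ring v (b i),
      forall c : 'I_d -> k, place_ideal v (\sum_i constF F (c i) * b i) ->
        forall i, c i = 0
    & forall x, place_ring v x -> exists c : 'I_d -> k,
        place_ideal v (x - \sum_i constF F (c i) * b i)].

Definition place_degree (k : finFieldType)
    (F : fieldExtType {fraction {poly k}}) (v : place F) (d : nat) : Prop :=
  exists b : 'I_d -> F, residue_basis v b.

Definition regular_away (F : fieldType) (infty : place F) : set F :=
  [set x | forall w : place F, ~ (w =1 infty) -> place_ring w x].

(* |x| = q ^ (- d v(x)), so that a uniformiser has absolute value q ^ (- d). *)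
Definition place_abs (R : realType) (F : fieldType) (q d : nat) (v : place F)
  (x : F) : R := if x == 0 then 0 else (q%:R ^+ d) ^ (- v x).

Record absval (R : realType) (K : fieldType) := AbsVal {
  absv :> K -> R;
  absv_ge0 : forall x, 0 <= absv x;
  absv_eq0 : forall x, absv x = 0 -> x = 0;
  absv0 : absv 0 = 0;
  absvM : forall x y, absv (x * y) = absv x * absv y;
  absvD : forall x y, absv (x + y) <= Num.max (absv x) (absv y)
}.

Definition av_complete (R : realType) (K : fieldType) (a : absval R K) : Prop :=
  forall u : nat -> K,
    (forall e : R, 0 < e -> exists N, forall m n,
       (N <= m)%N -> (N <= n)%N -> a (u m - u n) < e) ->
    exists l : K, (fun n => a (u n - l)) @ \oo --> (0 : R).

Definition is_completion (R : realType) (K L : fieldType) (aK : K -> R)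
    (aL : absval R L) (i : {rmorphism K -> L}) : Prop :=
  [/\ forall x, aL (i x) = aK x,
      forall (y : L) (e : R), 0 < e -> exists x : K, aL (y - i x) < e
    & av_complete aL].

(* In contrast with [is_completion], the absolute value on the closure is part
   of the data; it is the unique one extending that of the complete field K. *)
Definition is_algebraic_closure (R : realType) (K : fieldType)
    (L : closedFieldType) (aK : absval R K) (aL : absval R L)
    (i : {rmorphism K -> L}) : Prop :=
  (forall y : L, algebraicOver i y) /\ (forall x, aL (i x) = aK x).

(* The finite sums of products d * s with d in D and s in S, where F acts on C
   through i. For a subring D this is the D-submodule generated by S; for a
   D that is itself a submodule it is the product of modules D S. *)
Definition mod_span (F C : fieldType) (i : F -> C) (D : set F) (S : set C) :
    set C :=
  [set z | exists n (d : 'I_n -> F) (s : 'I_n -> C),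
     [/\ forall j, D (d j), forall j, S (s j)
       & z = \sum_j i (d j) * s j]].

(* The rank of a projective A-module L is the dimension over F of
   F (x)_A L; for L inside C, this is the F-subspace F L of C, as F is the
   fraction field of A and C is a field. *)
Definition has_rank (F C : fieldType) (i : F -> C) (L : set C) (n : nat) :
    Prop :=
  exists b : 'I_n -> C,
    (forall c : 'I_n -> F, \sum_j i (c j) * b j = 0 -> forall j, c j = 0) /\
    mod_span i setT L = mod_span i setT (range b).

Record lattice (R : realType) (F C : fieldType) (A : set F) (i : F -> C)
    (a : absval R C) (r : nat) := Lattice {
  lattice_set :> set C;
  lattice_fg : exists n (g : 'I_n -> C), lattice_set = mod_span i A (range g);
  lattice_discrete : forall t : R,
    finite_set (lattice_set `&` [set z | a z <= t]);
  lattice_rank : exists2 n, (n <= r)%N & has_rank i lattice_set n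
}.

(* The infinite product is the limit of the products over the finite subsets
   of L minus 0, ordered by inclusion. *)
Definition is_lattice_exp (R : realType) (C : fieldType) (a : absval R C)
    (L : set C) (z l : C) : Prop :=
  forall e : R, 0 < e ->
  exists2 S0 : {fset C}, [set` S0] `<=` L `\ 0 &
    forall S : {fset C}, [set` S0] `<=` [set` S] -> [set` S] `<=` L `\ 0 ->
      a (z * \prod_(x <- S) (1 - z / x) - l) < e.

Definition lattice_exp (R : realType) (C : fieldType) (a : absval R C)
  (L : set C) (z : C) : C := xget 0 (is_lattice_exp a L z).

(* An extended real, so that no boundedness is needed to form the supremum. *)
Definition lattice_dist (R : realType) (C : fieldType) (a : absval R C)
    (L1 L2 : set C) : \bar R :=
  ereal_sup [set (a (lattice_exp a L1 z - lattice_exp a L2 z))%:E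
            | z in [set z | a z <= 1]].

Definition lattice_ball (R : realType) (F C : fieldType) (A : set F)
    (i : F -> C) (a : absval R C) (r : nat)
    (L1 : lattice A i a r) (e : R) (L2 : lattice A i a r) : Prop :=
  (lattice_dist a L1 L2 < e%:E)%E.

Lemma absvN (R : realType) (K : fieldType) (a : absval R K) (x : K) :
  a (- x) = a x.
Proof.
have a1 : a 1 = 1.
  have /eqP := absvM a 1 1; rewrite mulr1 -{1}[a 1]mulr1.
  have n0 : a 1 != 0.
    by apply/eqP => /(@absv_eq0 _ _ a)/eqP; rewrite oner_eq0.
  by move=> /eqP /(mulfI n0).
have aN1 : a (-1) = 1.
  apply/eqP; rewrite -(@eqrXn2 _ 2) ?ler01 ?absv_ge0//.
  by rewrite expr1n expr2 -absvM mulrNN mulr1 a1.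
by rewrite -mulN1r absvM aN1 mul1r.
Qed.

Lemma lattice_ball_center (R : realType) (F C : fieldType) (A : set F)
    (i : F -> C) (a : absval R C) (r : nat) (x : lattice A i a r) (e : R) :
  0 < e -> lattice_ball x e x.
Proof.
move=> e0; rewrite /lattice_ball; apply: (@le_lt_trans _ _ 0%E).
  by apply: ge_ereal_sup => _ [z _ <-]; rewrite subrr absv0.
by rewrite lte_fin.
Qed.

Lemma lattice_ball_sym (R : realType) (F C : fieldType) (A : set F)
    (i : F -> C) (a : absval R C) (r : nat) (x y : lattice A i a r) (e : R) :
  lattice_ball x e y -> lattice_ball y e x.
Proof.
rewrite /lattice_ball; apply: le_lt_trans.
apply: ge_ereal_sup => _ [z z1 <-]; apply: ereal_sup_ubound.
by exists z => //; rewrite -absvN opprB.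
Qed.

Lemma lattice_ball_triangle (R : realType) (F C : fieldType) (A : set F)
    (i : F -> C) (a : absval R C) (r : nat) (x y z : lattice A i a r)
    (e1 e2 : R) :
  lattice_ball x e1 y -> lattice_ball y e2 z -> lattice_ball x (e1 + e2) z.
Proof.
rewrite /lattice_ball EFinD => h1 h2.
have e20 : (0 <= lattice_dist a y z)%E.
  apply: (@le_trans _ _ (a (lattice_exp a y 0 - lattice_exp a z 0))%:E).
    by rewrite lee_fin absv_ge0.
  by apply: ereal_sup_ubound; exists 0 => //=; rewrite absv0 ler01.
apply: le_lt_trans (lteD h1 h2).
apply: ge_ereal_sup => _ [w w1 <-].
rewrite -(subrKA (lattice_exp a y w)).
apply: (@le_trans _ _ ((a (lattice_exp a x w - lattice_exp a y w))%:E +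
   (a (lattice_exp a y w - lattice_exp a z w))%:E)%E).
  rewrite -EFinD lee_fin; apply: le_trans (absvD _ _ _) _.
  by rewrite ge_max lerDl lerDr !absv_ge0.
by apply: leeD; apply: ereal_sup_ubound; exists w.
Qed.

HB.instance Definition _ (R : realType) (F C : fieldType) (A : set F)
    (i : F -> C) (a : absval R C) (r : nat) :=
  gen_eqMixin (lattice A i a r).
HB.instance Definition _ (R : realType) (F C : fieldType) (A : set F)
    (i : F -> C) (a : absval R C) (r : nat) :=
  gen_choiceMixin (lattice A i a r).
HB.instance Definition _ (R : realType) (F C : fieldType) (A : set F)
    (i : F -> C) (a : absval R C) (r : nat) :=
  hasNbhs.Build (lattice A i a r)
    (nbhs_ (entourage_ (@lattice_ball R F C A i a r))).
(* The topology on lattices of rank at most r is the one induced by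
   [lattice_dist]. *)
HB.instance Definition _ (R : realType) (F C : fieldType) (A : set F)
    (i : F -> C) (a : absval R C) (r : nat) :=
  Nbhs_isPseudoMetric.Build R (lattice A i a r)
    erefl (@lattice_ball_center R F C A i a r)
    (@lattice_ball_sym R F C A i a r) (@lattice_ball_triangle R F C A i a r)
    erefl.

Lemma nbhs_latticeP (R : realType) (F C : fieldType) (A : set F)
    (i : F -> C) (a : absval R C) (r : nat) (L : lattice A i a r)
    (U : set (lattice A i a r)) :
  nbhs L U <-> exists2 e : R, 0 < e &
    forall L' : lattice A i a r, (lattice_dist a L L' < e%:E)%E -> U L'.
Proof.
by rewrite -nbhs_ballE; split=> -[e e0 h]; exists e.
Qed.

Definition nonzero_fractional_ideal (F : fieldType) (A J : set F) : Prop :=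
  [/\ forall x y, J x -> J y -> J (x + y),
      forall x y, A x -> J y -> J (x * y),
      exists2 x, x != 0 & J x
    & exists d, [/\ A d, d != 0 & forall x, J x -> A (d * x)]].

Definition ideal_inv (F : fieldType) (A J : set F) : set F :=
  [set x | forall y, J y -> A (x * y)].

(* The module J^-1 L. *)
Definition ideal_act (F C : fieldType) (A : set F) (i : F -> C) (J : set F)
  (L : set C) : set C := mod_span i (ideal_inv A J) L.

Definition homeomorphism (X Y : topologicalType) (f : X -> Y) : Prop :=
  continuous f /\
  exists g : Y -> X, [/\ cancel f g, cancel g f & continuous g].

(* Main.v *)
Require Import Defs.
From HB Require Import structures.
From mathcomp Require Import all_boot all_order all_algebra all_field.
From mathcomp Require Import finmap.
From mathcomp Require Import all_classical all_reals all_analysis.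
From mathcomp Require Import zify ring lra.

Set Implicit Arguments.
Unset Strict Implicit.
Unset Printing Implicit Defensive.

Import Order.TTheory GRing.Theory Num.Theory.
Import numFieldNormedType.Exports.

Local Open Scope classical_set_scope.
Local Open Scope ring_scope.

(** Why the theorem is true. Let A be the ring of functions regular away from
    the place infty, and let G be the inverse of the ideal J.

    Since J is invertible, 1 is a finite sum of products j g with j in J and
    g in G, and therefore G L is the set of all z with J z contained in L
    ([mod_span_dualE]). This description shows that G L is again a lattice of
    the same rank and that J (G L) = L; only continuity is at stake. It follows
    by comparing the metric with a cruder notion: L' is close to L when, inside
    a large ball, every point of either lattice is near a point of the other.

    - The action respects this notion, because a point z of G L is the sum of
      the g (j z), where the points j z of L lie in a larger ball and may be
      replaced by nearby points of L' ([close_points_mod_span]).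
    - Lattices that are close in a large ball have close exponentials on the
      unit ball: the points in the ball are matched bijectively, and those
      outside it contribute factors near 1 ([exp_close_of_close_in_ball]).
    - Conversely |e_L(z)| is at least the distance from z to L
      ([nearest_lattice_point]), so exponentials that are close on a ball force
      the lattice points in that ball to be close. But the metric controls the
      exponentials only on the unit ball, and this is where the bound on the
      rank enters. Fix alpha in A with |alpha| > 1. Then
      e_L(alpha z) = P(e_L(z)) for a polynomial P whose degree is at most the
      index of alpha L in L, and that index is bounded in terms of alpha and
      the rank only. Lagrange interpolation recovers P from boundedly many
      values of e_L in the unit ball, so closeness on a ball of radius rho
      spreads to the radius |alpha| rho, and hence to every ball
      ([ucvg_spread], [ucvg_close_in_ball]).

    Three facts about A are needed, and all are obtained by counting dimensions
    over the constants k. Counting degrees shows that boundedly many elements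
    of an F-vector space of dimension r are dependent over k[x]
    ([poly_dependence]); dividing such a relation by x bounds the dimension of
    M / x M over k for every A-module M of rank r ([module_quotient_kdep]).
    This gives the bound on the index, and also the finiteness of A / x A, from
    which the invertibility of ideals follows because A is completely
    integrally closed ([ideal_invertible]). The existence of alpha is a form of
    Riemann's inequality ([exists_pole]). *)

(** * Dimensions over a finite field *)

Lemma left_kernel_vector (k : fieldType) (I J : finType) (m : I -> J -> k) :
  (#|J| < #|I|)%N ->
  exists2 c : I -> k, exists i, c i != 0 & forall j, \sum_i c i * m i j = 0.
Proof.
move=> ltJI; pose M := \matrix_(i < #|I|, j < #|J|) m (enum_val i) (enum_val j).
have : kermx M != 0.
  rewrite -mxrank_eq0 mxrank_ker subn_eq0 -ltnNge.
  exact: leq_ltn_trans (rank_leq_col M) ltJI.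
case/rowV0Pn => v /sub_kermxP vM /rV0Pn [i0 vi0].
exists (fun i => v 0 (enum_rank i)); first by exists (enum_val i0); rewrite enum_valK.
move=> j; have := congr1 (fun A : 'rV_ _ => A 0 (enum_rank j)) vM.
rewrite !mxE => vM0; rewrite -[RHS]vM0 [RHS](reindex (@enum_rank I)) /=.
  by apply: eq_bigr => i _; rewrite !mxE !enum_rankK.
exact/onW_bij/enum_rank_bij.
Qed.

Section QuotientDimension.
Variables (k : finFieldType) (K : fieldType) (iota : {rmorphism k -> K}).

(** The dimension of M / N over k is at most d, expressed by linear dependence.
    Families are indexed by nat, of which only the first terms matter, so that
    they can be truncated and concatenated without casts. *)
Definition kdep (M N : set K) (d : nat) : Prop :=
  forall y : nat -> K, (forall i, (i <= d)%N -> M (y i)) ->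
  exists2 c : nat -> k, exists2 i, (i <= d)%N & c i != 0 &
    N (\sum_(i < d.+1) iota (c i) * y i).

(** The dimension of M / N over k is at most d, expressed by generators. *)
Definition kspan (M N : set K) (d : nat) : Prop :=
  exists2 b : nat -> K, forall i, (i < d)%N -> M (b i) &
    forall x, M x -> exists c : nat -> k, N (x - \sum_(i < d) iota (c i) * b i).

Definition ksub (N : set K) : Prop :=
  [/\ N 0, forall x y, N x -> N y -> N (x + y)
    & forall c x, N x -> N (iota c * x)].

Lemma ksubN N x : ksub N -> N x -> N (- x).
Proof. by case=> _ _ NZ /(NZ (-1)); rewrite rmorphN1 mulN1r. Qed.

Lemma ksubB N x y : ksub N -> N x -> N y -> N (x - y).
Proof. by move=> sN Nx Ny; case: (sN) => _ ND _; apply: ND => //; apply: ksubN. Qed.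

Lemma ksub_sum N (I : Type) (r : seq I) (P : pred I) (f : I -> K) :
  ksub N -> (forall i, P i -> N (f i)) -> N (\sum_(i <- r | P i) f i).
Proof. by move=> [N0 ND _] Nf; apply: (big_ind N). Qed.

Lemma kspan_family M N d (I : finType) (y : I -> K) :
  ksub N -> kspan M N d -> (d < #|I|)%N -> (forall i, M (y i)) ->
  exists2 c : I -> k, exists i, c i != 0 & N (\sum_i iota (c i) * y i).
Proof.
move=> sN [b Mb spn] dI My.
have /choice [C HC] : forall i, exists c : nat -> k,
    N (y i - \sum_(j < d) iota (c j) * b j) by move=> i; apply: spn.
have [|c c0 HM] := @left_kernel_vector k I 'I_d (fun i j => C i j).
  by rewrite card_ord.
exists c => //.
have -> : \sum_i iota (c i) * y i =
    \sum_i iota (c i) * (y i - \sum_(j < d) iota (C i j) * b j).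
  apply: subr0_eq; rewrite -sumrB.
  transitivity (\sum_i \sum_(j < d) iota (c i) * (iota (C i j) * b j)).
    by apply: eq_bigr => i _; rewrite mulrBr opprB addrC subrK mulr_sumr.
  rewrite exchange_big big1 //= => j _.
  under eq_bigr do rewrite mulrA -rmorphM.
  by rewrite -mulr_suml -rmorph_sum HM rmorph0 mul0r.
apply: ksub_sum => // i _; case: sN => _ _; apply; exact: HC.
Qed.

Lemma kspan_leq M N d d' : M 0 -> (d <= d')%N -> kspan M N d -> kspan M N d'.
Proof.
move=> M0 dd' [b Mb spn].
exists (fun i => if (i < d)%N then b i else 0) => [i _|x /spn [c Nc]].
  by case: ifP => // /Mb.
exists (fun i => if (i < d)%N then c i else 0); congr N: Nc; congr (_ - _).
rewrite (big_ord_widen _ (fun i => iota (c i) * b i) dd') big_mkcond.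
by apply: eq_bigr => i _; case: ifP => // _; rewrite mulr0.
Qed.

(** By induction on d: an independent family of the largest possible size
    spans. *)
Lemma kdep_kspan M N d : ksub M -> ksub N -> kdep M N d -> kspan M N d.
Proof.
move=> sM sN; elim: d => [|d IH] dep.
  exists (fun=> 0) => // x Mx; exists (fun=> 0); rewrite big_ord0 subr0.
  have [//|c [i]] := dep (fun=> x); rewrite leqn0 => /eqP -> c0.
  rewrite big_ord1 => Ncx; case: (sN) => _ _ /(_ (c 0)^-1 _ Ncx).
  by rewrite mulrA -rmorphM mulVf// rmorph1 mul1r.
have [/IH|nd] := EM (kdep M N d).
  by apply: kspan_leq => //; case: sM.
have [y /not_implyP [My ind]] : exists y : nat -> K, ~ ((forall i, (i <= d)%N -> M (y i)) ->
  exists2 c : nat -> k, exists2 i, (i <= d)%N & c i != 0 &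
    N (\sum_(i < d.+1) iota (c i) * y i)) by apply/existsNP.
exists y => // x Mx.
have [|c [i0 id ci0]] := dep (fun i => if (i <= d)%N then y i else x).
  by move=> i _; case: ifP => [/My|].
rewrite big_ord_recr /= ltnn.
under eq_bigr => i _ do rewrite -ltnS ltn_ord.
move=> Nc; have cd : c d.+1 != 0.
  apply/eqP => cd; apply: ind; exists c.
    exists i0 => //; rewrite leqNgt; apply/negP => di0.
    by case/negP: ci0; rewrite (_ : i0 = d.+1) ?cd//; apply/eqP; rewrite eqn_leq id.
  by move: Nc; rewrite cd rmorph0 mul0r addr0.
exists (fun i => - (c i / c d.+1)).
case: (sN) => _ _ /(_ (c d.+1)^-1 _ Nc); congr N.
rewrite mulrDr addrC mulrA -rmorphM mulVf// rmorph1 mul1r; congr (_ + _).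
rewrite mulr_sumr -sumrN; apply: eq_bigr => i _.
by rewrite mulrA -rmorphM rmorphN mulNr opprK [_^-1 * _]mulrC.
Qed.

Lemma kspan_trans M N P d1 d2 : ksub M -> (forall x, N x -> M x) ->
  kspan M N d1 -> kspan N P d2 -> kspan M P (d1 + d2).
Proof.
move=> sM NM [b1 Mb1 s1] [b2 Nb2 s2].
exists (fun i => if (i < d1)%N then b1 i else b2 (i - d1)%N) => [i id|x /s1 [c1 /s2[c2 Pc]]].
  case: ifPn => [/Mb1//|]; rewrite -leqNgt => di; apply/NM/Nb2.
  by rewrite ltn_subLR.
exists (fun i => if (i < d1)%N then c1 i else c2 (i - d1)%N).
congr P: Pc; rewrite big_split_ord /= opprD addrA; congr (_ - _ - _).
  by apply: eq_bigr => i _; rewrite ltn_ord.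
by apply: eq_bigr => i _; rewrite ltnNge leq_addr /= addKn.
Qed.

Lemma kspan_finite_reps M N d : ksub M -> kspan M N d ->
  exists2 s : {ffun 'I_d -> k} -> K, forall c, M (s c) &
    forall x, M x -> exists c, N (x - s c).
Proof.
move=> sM [b Mb spn]; exists (fun c => \sum_(i < d) iota (c i) * b i).
  move=> c; apply: ksub_sum => // i _.
  by case: (sM) => _ _; apply; apply: Mb.
move=> x /spn [c Nc]; exists [ffun i : 'I_d => c i].
by under eq_bigr do rewrite ffunE.
Qed.

End QuotientDimension.

(** * Polynomial dependence in a function field *)

Lemma fraction_numden (D : idomainType) (c : {fraction D}) :
  exists2 d : D, d != 0 &
    exists n : D, FracField.tofrac d * c = FracField.tofrac n.
Proof.
elim/quotW: c => x; exists (frac x).2; first exact: denom_ratioP.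
exists (frac x).1; rewrite !piE; apply/eqmodP; rewrite /= FracField.equivfE.
by rewrite /FracField.mulf !numden_Ratio ?mulf_neq0 ?oner_eq0 ?denom_ratioP// !mulr1 !mul1r mulrC.
Qed.

Section FunctionField.
Variables (k : finFieldType) (F : fieldExtType {fraction {poly k}}).

Definition poly_in : {poly k} -> F := in_alg F \o @FracField.tofrac {poly k}.
HB.instance Definition _ := GRing.RMorphism.on poly_in.

Definition const_in : k -> F := poly_in \o polyC.
HB.instance Definition _ := GRing.RMorphism.on const_in.

Lemma poly_in_eq0 p : (poly_in p == 0) = (p == 0).
Proof. by rewrite fmorph_eq0 tofrac_eq0. Qed.

Let n := \dim {:F}.
Let b (j : 'I_n) : F := (vbasis {:F})`_j.

Let bdd (N : nat) (z : F) := exists2 p : 'I_n -> {poly k},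
  forall j, (size (p j) <= N)%N & z = \sum_j poly_in (p j) * b j.

Let bddD N x y : bdd N x -> bdd N y -> bdd N (x + y).
Proof.
move=> [p sp ->] [q sq ->]; exists (fun j => p j + q j).
  by move=> j; rewrite (leq_trans (size_polyD _ _))// geq_max sp sq.
by rewrite -big_split; apply: eq_bigr => j _; rewrite rmorphD mulrDl.
Qed.

Let bdd0 N : bdd N 0.
Proof.
exists (fun=> 0) => [j|]; rewrite ?size_poly0// big1// => j _.
by rewrite rmorph0 mul0r.
Qed.

Let bdd_sum N (I : Type) (r : seq I) (f : I -> F) :
  (forall i, bdd N (f i)) -> bdd N (\sum_(i <- r) f i).
Proof.
by move=> bf; apply: (big_ind (bdd N)) => [||//]; [exact: bdd0|exact: bddD].
Qed.

Let bdd_leq N M z : (N <= M)%N -> bdd N z -> bdd M z.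
Proof. by move=> NM [p sp ->]; exists p => // j; apply: leq_trans NM. Qed.

Let bddZ N (h : {poly k}) z : bdd N z -> bdd (N + size h) (poly_in h * z).
Proof.
move=> [p sp ->]; exists (fun j => h * p j).
  move=> j; apply: leq_trans (size_polyMleq _ _) _.
  by rewrite addnC (leq_trans (leq_pred _))// leq_add2r.
by rewrite mulr_sumr; apply: eq_bigr => j _; rewrite rmorphM mulrA.
Qed.

Let bdd_common (I : finType) (z : I -> F) :
  exists2 g, g != 0 & exists N, forall i, bdd N (poly_in g * z i).
Proof.
have /choice [G HG] : forall ij : I * 'I_n, exists dn : {poly k} * {poly k},
    dn.1 != 0 /\ FracField.tofrac dn.1 * coord (vbasis {:F}) ij.2 (z ij.1)
              = FracField.tofrac dn.2.
  move=> [i j]; have [d d0 [m e]] := fraction_numden (coord (vbasis {:F}) j (z i)).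
  by exists (d, m).
exists (\prod_ij (G ij).1).
  by apply/prodf_neq0 => ij _; case: (HG ij).
pose p i j := (\prod_(ij | ij != (i, j)) (G ij).1) * (G (i, j)).2.
exists (\max_i \max_j size (p i j)) => i; exists (p i).
  move=> j; apply: (@leq_trans (\max_j size (p i j))).
    exact: (@leq_bigmax _ (fun j => size (p i j)) j).
  exact: (@leq_bigmax _ (fun i => \max_j size (p i j)) i).
rewrite {1}(coord_vbasis (memvf (z i))) mulr_sumr; apply: eq_bigr => j _.
rewrite -[_ *: _]mulr_algl mulrA; congr (_ * _).
rewrite (bigD1 (i, j)) //= mulrC rmorphM /= mulrA [_ * poly_in (G (i, j)).1]mulrC.
have [_ e] := HG (i, j).
have -> : poly_in (G (i, j)).1 * (coord (vbasis {:F}) j (z i))%:A = poly_in (G (i, j)).2.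
  by rewrite -[RHS]/(in_alg F (FracField.tofrac (G (i, j)).2)) -e rmorphM.
by rewrite -rmorphM mulrC.
Qed.

Let bdd_dep (I : finType) (r N : nat) (z : I -> nat -> F) :
  (forall i j, bdd N (z i j)) -> (r * (n * N) < #|I|)%N ->
  exists2 c : I -> k, exists i, c i != 0 &
    forall j, (j < r)%N -> \sum_i const_in (c i) * z i j = 0.
Proof.
move=> bz ltI.
have /choice [P HP] : forall ij : I * nat, exists p : 'I_n -> {poly k},
    (forall j, (size (p j) <= N)%N) /\ z ij.1 ij.2 = \sum_j poly_in (p j) * b j.
  by move=> [i j]; have [p] := bz i j; exists p.
have [|c ci HM] := @left_kernel_vector k I ('I_r * ('I_n * 'I_N))%type
    (fun i jl => (P (i, val jl.1) jl.2.1)`_jl.2.2).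
  by rewrite !card_prod !card_ord.
exists c => // j jr.
under eq_bigr => i _.
  rewrite (HP (i, j)).2 mulr_sumr.
  under eq_bigr do rewrite /const_in /= mulrA -rmorphM.
  over.
rewrite exchange_big big1 //= => l _.
rewrite -mulr_suml -rmorph_sum (_ : \sum_i _ = 0) ?rmorph0 ?mul0r //.
apply/polyP => m; rewrite coef_sum coef0.
under eq_bigr do rewrite coefCM.
have [mN|Nm] := ltnP m N; first exact: (HM (Ordinal jr, (l, Ordinal mN))).
apply: big1 => i _; rewrite nth_default ?mulr0 //.
exact: leq_trans ((HP (i, j)).1 l) Nm.
Qed.

(** Write elements of F in a basis over k(t), and let h be a common denominator
    of the multiplication by x. For a family z of vectors of F^r, the products
    h^L x^l z with l <= L have, up to a common denominator, polynomial
    coordinates of degree at most L e + O(1), where e depends on x only. Hence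
    they lie in a space of dimension r n e L + O(1) over k, and d + 1 vectors z
    yield (d + 1) (L + 1) of them: as soon as d = r n e, they are dependent for
    large L. *)
Lemma poly_dependence (x : F) (r : nat) : exists d, forall z : nat -> nat -> F,
  exists2 p : nat -> {poly k}, exists2 i, (i <= d)%N & p i != 0 &
    forall j, (j < r)%N ->
      \sum_(i < d.+1) (map_poly const_in (p i)).[x] * z i j = 0.
Proof.
have [h h0 [e0 be0]] := bdd_common (fun j => x * b j).
pose e := (e0 + size h)%N.
have bhx N z : bdd N z -> bdd (N + e) (poly_in h * x * z).
  move=> [p sp ->]; rewrite mulr_sumr; apply: bdd_sum => j.
  rewrite mulrCA -mulrA; apply: (@bdd_leq (e0 + size (p j))).
    by rewrite addnC leq_add// leq_addr.
  exact: bddZ.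
have bh N z : bdd N z -> bdd (N + e) (poly_in h * z).
  by move=> /(@bddZ _ h); apply: bdd_leq; rewrite leq_add2l leq_addl.
have bX N L l z : (l <= L)%N -> bdd N z ->
    bdd (N + L * e) (poly_in h ^+ L * x ^+ l * z).
  elim: L l => [|L IH] [|l] // lL bz.
  - by rewrite mul0n addn0 !mul1r.
  - rewrite mulSn addnCA addnC exprS -!mulrA; apply: bh.
    by rewrite mulrA; apply: (IH 0).
  - rewrite mulSn addnCA addnC 2!exprS mulrACA -mulrA mulrA -[X in bdd _ X]mulrA; apply: bhx.
    exact: IH.
exists (r * n * e)%N => z.
pose d := (r * n * e)%N.
have [g g0 [N0 bN0]] := @bdd_common ('I_d.+1 * 'I_r)%type (fun ij => z ij.1 ij.2).
(* Here r n (N0 + L e) = L + d L is less than (d + 1) (L + 1). *)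
pose L := (r * n * N0)%N.
pose Z (il : 'I_d.+1 * 'I_L.+1) (j : nat) : F := if (j < r)%N
  then poly_in h ^+ L * x ^+ il.2 * (poly_in g * z il.1 j) else 0.
have [||c [[i0 l0] c0] Hc] := @bdd_dep _ r (N0 + L * e) Z.
- move=> [i l] j; rewrite /Z /=; case: ifP => jr.
    apply: bX; first by rewrite -ltnS.
    exact: (bN0 (i, Ordinal jr)).
  exact: bdd0.
- rewrite card_prod !card_ord.
  have -> : (r * (n * (N0 + L * e)) = L + d * L)%N.
    by rewrite /d; move: (e) => e'; rewrite !mulnDr (mulnC L) !mulnA.
  by rewrite mulSn mulnS addSn ltnS leq_add2l leq_addl.
exists (fun i => \poly_(l < L.+1) c (inord i, inord l)).
  exists i0; first by rewrite -ltnS.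
  apply/eqP => /polyP /(_ l0); rewrite coef_poly ltn_ord coef0 !inord_val.
  exact/eqP.
move=> j jr; have := Hc j jr.
rewrite (_ : \sum_i _ = poly_in h ^+ L * poly_in g *
   \sum_(i < d.+1) (map_poly const_in (\poly_(l < L.+1) c (inord i, inord l))).[x] * z i j).
  move/eqP; rewrite !mulf_eq0 expf_eq0 !poly_in_eq0 (negPf h0) (negPf g0) andbF /=.
  by move/eqP.
rewrite mulr_sumr (eq_bigr (fun il => const_in (c (il.1, il.2)) * Z (il.1, il.2) j)); last by case.
rewrite -(pair_bigA _ (fun i l => const_in (c (i, l)) * Z (i, l) j)) /=.
apply: eq_bigr => i _.
rewrite (@horner_coef_wide _ L.+1); last first.
  by apply: leq_trans (size_poly _ _) _; apply: size_poly.
rewrite mulrCA mulr_suml.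
apply: eq_bigr => l _; rewrite coef_map coef_poly ltn_ord !inord_val /Z jr /=.
by rewrite -[RHS]mulrA; congr (_ * _); rewrite -!mulrA mulrCA.
Qed.

End FunctionField.

(** * The quotient of a module by a multiple of itself *)

Section DivideByX.
Variables (k : finFieldType) (K : fieldType) (iota : {rmorphism k -> K}).
Variables (x : K) (M : set K).
Hypotheses (x0 : x != 0) (sM : ksub iota M) (Mx : forall y, M y -> M (x * y)).

Definition scaled (x : K) (M : set K) : set K := [set z | exists2 w, M w & z = x * w].

Lemma ksub_scaled : ksub iota (scaled x M).
Proof.
case: sM => M0 MD MZ; split.
- by exists 0 => //; rewrite mulr0.
- by move=> _ _ [u Mu ->] [v Mv ->]; exists (u + v); [exact: MD|rewrite mulrDr].
- by move=> c _ [u Mu ->]; exists (iota c * u); [exact: MZ|rewrite mulrCA].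
Qed.

Lemma horner_closed p y : M y -> M ((map_poly iota p).[x] * y).
Proof.
case: sM => M0 MD MZ.
elim/poly_ind: p y => [|p c IH] y My; first by rewrite rmorph0 horner0 mul0r.
rewrite rmorphD rmorphM /= map_polyX map_polyC hornerD hornerM hornerX hornerC mulrDl -mulrA.
by apply: MD; [apply/IH/Mx|apply: MZ].
Qed.

(** Divide the coefficients of a relation over k[x] by x as long as all of them
    have constant term 0. The constant terms of the resulting relation are the
    coefficients of a relation over k modulo x M. *)
Lemma kdep_of_relation d :
  (forall y : nat -> K, (forall i, (i <= d)%N -> M (y i)) ->
     exists2 p : nat -> {poly k}, exists2 i, (i <= d)%N & p i != 0 &
       \sum_(i < d.+1) (map_poly iota (p i)).[x] * y i = 0) ->
  kdep iota M (scaled x M) d.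
Proof.
move=> rel y My; have [p p0 Hp] := rel y My; move: p p0 Hp.
(* Induction on a bound for the sizes of the coefficients. *)
suff H N : forall p : nat -> {poly k}, (forall i, (i <= d)%N -> (size (p i) <= N)%N) ->
    (exists2 i, (i <= d)%N & p i != 0) ->
    \sum_(i < d.+1) (map_poly iota (p i)).[x] * y i = 0 ->
    exists2 c : nat -> k, exists2 i, (i <= d)%N & c i != 0 &
      scaled x M (\sum_(i < d.+1) iota (c i) * y i).
  move=> p; apply: (H (\max_(i < d.+1) size (p i))) => i id.
  exact: (@leq_bigmax _ (fun i : 'I_d.+1 => size (p i)) (Ordinal (id : (i < d.+1)%N))).
elim: N => [|N IH] p sp [i0 i0d pi0] Hp.
  by move: (sp _ i0d); rewrite leqn0 size_poly_eq0 (negPf pi0).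
have /choice [qc Hqc] : forall i, exists qc : {poly k} * k, p i = qc.1 * 'X + qc.2%:P.
  move=> i; elim/poly_ind: (p i) => [|q c _]; last by exists (q, c).
  by exists (0, 0); rewrite mul0r add0r.
have HX i : (map_poly iota (p i)).[x] * y i =
    x * ((map_poly iota (qc i).1).[x] * y i) + iota (qc i).2 * y i.
  rewrite Hqc rmorphD rmorphM /= map_polyX map_polyC hornerD hornerM hornerX hornerC mulrDl -!mulrA.
  by rewrite mulrCA.
have [[i id ci]|nc] := EM (exists2 i, (i <= d)%N & (qc i).2 != 0).
  exists (fun i => (qc i).2); first by exists i.
  exists (- \sum_(i < d.+1) (map_poly iota (qc i).1).[x] * y i).
    apply: (ksubN sM); apply: (ksub_sum _ sM) => j _; apply: horner_closed.
    by apply: My; rewrite -ltnS.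
  move: Hp; under eq_bigr do rewrite HX.
  rewrite big_split -mulr_sumr /= mulrN => /eqP; rewrite addrC addr_eq0 => /eqP.
  by [].
have c0 i : (i <= d)%N -> (qc i).2 = 0.
  by move=> id; apply/eqP; apply: contraPT nc => ci; apply; exists i.
apply: (IH (fun i => (qc i).1)).
- move=> i id; have := sp i id.
  by rewrite Hqc size_MXaddC; case: ifP => // /andP[/eqP -> _] _; rewrite size_poly0.
- exists i0 => //; apply: contraNneq pi0 => q0.
  by rewrite Hqc q0 c0// mul0r add0r.
- move: Hp; under eq_bigr => i _ do rewrite HX c0 -1?ltnS// rmorph0 mul0r addr0.
  by rewrite -mulr_sumr => /eqP; rewrite mulf_eq0 (negPf x0) => /eqP.
Qed.

End DivideByX.

(** The bound is uniform in M; this will bound the index of alpha L in L for all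
    lattices L at once. *)
Lemma module_quotient_kdep (k : finFieldType) (F : fieldExtType {fraction {poly k}})
    (C : fieldType) (phi : {rmorphism F -> C}) (x : F) (r : nat) : x != 0 ->
  exists d, forall (M : set C) (b : nat -> C),
    ksub (phi \o @const_in k F) M -> (forall y, M y -> M (phi x * y)) ->
    (forall y, M y -> exists c : nat -> F, y = \sum_(j < r) phi (c j) * b j) ->
    kdep (phi \o @const_in k F) M (scaled (phi x) M) d.
Proof.
move=> x0; have [d Hd] := poly_dependence x r; exists d => M b sM Mx Mb.
apply: kdep_of_relation => //; first by rewrite fmorph_eq0.
move=> y My.
have /choice [z Hz] : forall i, exists c : nat -> F, (i <= d)%N ->
    y i = \sum_(j < r) phi (c j) * b j.
  move=> i; have [/My/Mb [c ->]|_] := boolP (i <= d)%N; first by exists c.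
  by exists (fun=> 0).
have [p p0 Hp] := Hd z; exists p => //.
transitivity (\sum_(i < d.+1) \sum_(j < r)
    phi ((map_poly (@const_in k F) (p i)).[x] * z i j) * b j).
  apply: eq_bigr => i _; rewrite Hz -1?ltnS// mulr_sumr; apply: eq_bigr => j _.
  by rewrite rmorphM mulrA map_poly_comp horner_map.
rewrite exchange_big big1 //= => j _.
by rewrite -mulr_suml -rmorph_sum Hp// rmorph0 mul0r.
Qed.

(** * Discrete valuations and weak approximation *)

Section Places.
Variable F : fieldType.
Implicit Types (v w : place F) (x y z : F) (m : int).

Lemma place1 w : w 1 = 0.
Proof.
have := place_valM w (oner_neq0 F) (oner_neq0 F).
by rewrite mulr1; move: (w 1) => m; lia.
Qed.

Lemma placeV w x : w x^-1 = - w x.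
Proof.
have [->|x0] := eqVneq x 0; first by rewrite invr0 place_val0 oppr0.
have := place_valM w x0 (_ : x^-1 != 0).
rewrite divff// place1 invr_eq0 => /(_ x0).
by move: (w x) (w x^-1) => a b; lia.
Qed.

Lemma placeX w x (n : nat) : w (x ^+ n) = w x *+ n.
Proof.
have [->|x0] := eqVneq x 0.
  by case: n => [|n]; rewrite ?expr0 ?place1 // expr0n /= place_val0 mul0rn.
elim: n => [|n IH]; first by rewrite place1.
by rewrite exprS mulrS place_valM ?expf_neq0// IH.
Qed.

Lemma placeXz w x (n : int) : w (x ^ n) = w x * n.
Proof.
case: n => n; first by rewrite -exprnP placeX -mulr_natr natz.
by rewrite NegzE -exprnN placeV placeX mulrN -mulr_natr natz.
Qed.

Lemma placeN w x : w (- x) = w x.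
Proof.
have [->|x0] := eqVneq x 0; first by rewrite oppr0.
rewrite -mulN1r place_valM ?oppr_eq0 ?oner_eq0//.
by have := placeX w (-1) 2; rewrite sqrrN expr1n place1; lia.
Qed.

(** A comparison that holds for x = 0, whose valuation is +oo. *)
Definition vge w m x := x = 0 \/ m <= w x.

Lemma vge_neq0 w m x : x != 0 -> vge w m x -> m <= w x.
Proof. by move=> /eqP x0 []. Qed.

Lemma vge1 w : vge w 0 1. Proof. by right; rewrite place1. Qed.

Lemma vgeD w m x y : vge w m x -> vge w m y -> vge w m (x + y).
Proof.
move=> [->|mx] [->|my]; rewrite ?(add0r, addr0); try by [left|right].
have [->|x0] := eqVneq x 0; first by rewrite add0r; right.
have [->|y0] := eqVneq y 0; first by rewrite addr0; right.
have [->|xy0] := eqVneq (x + y) 0; first by left.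
by right; apply: (le_trans _ (place_valD w x0 y0 xy0)); rewrite le_min mx.
Qed.

Lemma vgeN w m x : vge w m x -> vge w m (- x).
Proof. by move=> [->|?]; [left; rewrite oppr0|right; rewrite placeN]. Qed.

Lemma vgeB w m x y : vge w m x -> vge w m y -> vge w m (x - y).
Proof. by move=> ? /vgeN; apply: vgeD. Qed.

Lemma vgeM w m1 m2 m x y : m = m1 + m2 -> vge w m1 x -> vge w m2 y -> vge w m (x * y).
Proof.
move=> ->; have [->|x0] := eqVneq x 0; first by rewrite mul0r; left.
have [->|y0] := eqVneq y 0; first by rewrite mulr0; left.
by move=> /(vge_neq0 x0) ? /(vge_neq0 y0) ?; right; rewrite place_valM// lerD.
Qed.

Lemma vge_le w m1 m2 x : m1 <= m2 -> vge w m2 x -> vge w m1 x.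
Proof. by move=> m12 [->|h]; [left|right; apply: (le_trans m12 h)]. Qed.

Lemma vge_sum w m (I : Type) (r : seq I) (P : pred I) (f : I -> F) :
  (forall i, P i -> vge w m (f i)) -> vge w m (\sum_(i <- r | P i) f i).
Proof. by move=> h; apply: (big_ind (vge w m)) => // [|x y]; [left|apply: vgeD]. Qed.

Lemma vge_refl w x : vge w (w x) x. Proof. by right. Qed.

Lemma vge0M w x y : vge w 0 x -> vge w 0 y -> vge w 0 (x * y).
Proof. exact: vgeM. Qed.

Lemma vge0X w x n : vge w 0 x -> vge w 0 (x ^+ n).
Proof.
move=> h; elim: n => [|n IH]; first exact: vge1.
by rewrite exprS; apply: vge0M.
Qed.

Lemma place_lt0_neq0 w x : w x < 0 -> x != 0.
Proof. by apply: contraTneq => ->; rewrite place_val0. Qed.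

Lemma place_gt0_neq0 w x : 0 < w x -> x != 0.
Proof. by apply: contraTneq => ->; rewrite place_val0. Qed.

Lemma placeD_lt w x y : x != 0 -> vge w (w x + 1) y -> x + y != 0 /\ w (x + y) = w x.
Proof.
move=> x0 vy.
have nge : ~ vge w (w x + 1) (x + y).
  by move=> h; have := vgeB h vy; rewrite addrK => /(vge_neq0 x0); lia.
have xy0 : x + y != 0 by apply/eqP => h; apply: nge; left.
split=> //; apply/eqP; rewrite eq_le; apply/andP; split.
  by rewrite leNgt; apply/negP => h; apply: nge; right; lia.
apply: vge_neq0 => //; apply: vgeD; first exact: vge_refl.
by apply: vge_le vy; lia.
Qed.

(** Under the inclusion of valuation rings, units for w are units for v, so v is
    a multiple of w; both take the value 1, so the factor is 1. *)
Lemma place_ring_incl_eq v w : (forall x, place_ring w x -> place_ring v x) -> w =1 v.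
Proof.
move=> incl.
have unit x : w x = 0 -> v x = 0.
  have [->|x0] := eqVneq x 0; first by rewrite !place_val0.
  move=> wx; have := vge_neq0 x0 (incl x (or_intror _)).
  rewrite wx => /(_ isT) vx.
  have xV0 : x^-1 != 0 by rewrite invr_eq0.
  have := vge_neq0 xV0 (incl x^-1 (or_intror _)).
  by rewrite !placeV wx => /(_ isT); lia.
have [p p0 wp] := place_val_uniformiser w.
have val x : x != 0 -> v x = w x * v p.
  move=> x0; have px0 : p ^ (- w x) != 0 by rewrite expfz_neq0.
  have := unit (x * p ^ (- w x)); rewrite !place_valM// !placeXz wp => /(_ _).
  by rewrite mul1r subrr => /(_ erefl); lia.
have [t t0 vt] := place_val_uniformiser v.
have := val t t0; rewrite vt => e.
have vp : 0 <= v p by apply: (vge_neq0 p0 (incl p (or_intror _))); rewrite wp.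
have vp1 : v p = 1.
  have := congr1 absz e; rewrite abszM /= => /esym/eqP; rewrite muln_eq1 => /andP[_ /eqP].
  by lia.
move=> x; have [->|x0] := eqVneq x 0; first by rewrite !place_val0.
by rewrite val// vp1 mulr1.
Qed.

Lemma separate_pair v w : ~ (w =1 v) -> exists2 z, v z < 0 & 0 < w z.
Proof.
move=> nwv.
have sep (v' w' : place F) : ~ (w' =1 v') -> exists2 x, 0 <= w' x & v' x < 0.
  move=> ne; apply/not_exists2P => h; apply: ne; apply: place_ring_incl_eq => x.
  case=> [->|wx]; first by left.
  by right; case: (h x) => // /negP; rewrite -leNgt.
have [x wx vx] := sep _ _ nwv.
have [y vy wy] : exists2 x, 0 <= v x & w x < 0 by apply: sep => h; apply: nwv => t; rewrite h.
have x0 := place_lt0_neq0 vx; have y0 := place_lt0_neq0 wy.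
by exists (x / y); rewrite place_valM ?invr_eq0// placeV; lia.
Qed.

(** For the next two lemmas: z^n / (1 + z^n) is close to 0 where z has a zero
    and close to 1 where z has a pole, increasingly so as n grows. *)
Lemma frac_large w z N : 0 < w z ->
  w (z ^+ N.+1 / (1 + z ^+ N.+1)) = w z *+ N.+1.
Proof.
move=> wz; have z0 := place_gt0_neq0 wz.
have [|d0 d1] := @placeD_lt w 1 (z ^+ N.+1) (oner_neq0 _).
  by right; rewrite place1 placeX; lia.
by rewrite place_valM ?expf_neq0 ?invr_eq0// placeV d1 place1 subr0 placeX.
Qed.

Lemma frac_small w z N : w z < 0 ->
  [/\ 1 + z ^+ N.+1 != 0, w (z ^+ N.+1 / (1 + z ^+ N.+1)) = 0
    & w (1 - z ^+ N.+1 / (1 + z ^+ N.+1)) = - w z *+ N.+1].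
Proof.
move=> wz; have z0 := place_lt0_neq0 wz.
have [||d0 d1] := @placeD_lt w (z ^+ N.+1) 1; first by rewrite expf_neq0.
  by right; rewrite place1 placeX; lia.
rewrite [_ + 1]addrC in d0 d1; split=> //.
  by rewrite place_valM ?expf_neq0 ?invr_eq0// placeV d1 subrr.
have -> : 1 - z ^+ N.+1 / (1 + z ^+ N.+1) = (1 + z ^+ N.+1)^-1.
  by rewrite -{1}(divff d0) -mulrBl addrK div1r.
by rewrite placeV d1 placeX mulNrn.
Qed.

(** Given z that works for the first s places and y that separates v from the
    next place w, a high power of z times y works if w z = 0. If w z < 0, use
    z^n / (1 + z^n) instead of z^n, which is a unit at v and at w. *)
Lemma separate_places v (ws : nat -> place F) s :
  (forall i, (i < s)%N -> ~ (ws i =1 v)) ->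
  exists2 z, v z < 0 & forall i, (i < s)%N -> 0 < ws i z.
Proof.
elim: s => [|s IH] ne.
  have [z z0 vz] := place_val_uniformiser v.
  by exists z^-1; rewrite ?placeV ?vz.
have [|z vz wz] := IH; first by move=> i si; apply/ne/ltnW.
have [y vy wy] := separate_pair (ne s (ltnSn s)).
have z0 := place_lt0_neq0 vz; have y0 := place_lt0_neq0 vy.
pose N := (\max_(i < s) `|ws i y|)%N.
have HN i : (i < s)%N -> `|ws i y| <= N%:Z.
  move=> si; rewrite -abszE lez_nat.
  exact: (@leq_bigmax _ (fun i : 'I_s => `|ws i y|%N) (Ordinal si)).
have big i : (i < s)%N -> 0 < ws i z *+ N.+1 + ws i y.
  by move=> si; have := wz _ si; have := HN _ si; rewrite -mulr_natr natz; nia.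
case: (ltgtP (ws s z) 0) => wsz.
- have [d0 e1 _] := frac_small N wsz; have [_ e2 _] := frac_small N vz.
  exists (z ^+ N.+1 / (1 + z ^+ N.+1) * y).
    by rewrite place_valM ?mulf_neq0 ?expf_neq0 ?invr_eq0// e2 add0r.
  move=> i; rewrite ltnS leq_eqVlt => /predU1P[->|si].
    by rewrite place_valM ?mulf_neq0 ?expf_neq0 ?invr_eq0// e1 add0r.
  by rewrite place_valM ?mulf_neq0 ?expf_neq0 ?invr_eq0// frac_large ?wz// big.
- exists z => // i; rewrite ltnS leq_eqVlt => /predU1P[->//|]; exact: wz.
- exists (z ^+ N.+1 * y).
    by rewrite place_valM ?expf_neq0// placeX -mulr_natr natz; nia.
  move=> i; rewrite ltnS leq_eqVlt => /predU1P[->|si].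
    by rewrite place_valM ?expf_neq0// placeX wsz mul0rn add0r.
  by rewrite place_valM ?expf_neq0// placeX big.
Qed.

Lemma weak_approximation v (ws : nat -> place F) s (N : nat) :
  (forall i, (i < s)%N -> ~ (ws i =1 v)) ->
  exists2 e, vge v N%:Z (1 - e) & forall i, (i < s)%N -> vge (ws i) N%:Z e.
Proof.
move=> /separate_places[z vz wz]; exists (z ^+ N.+1 / (1 + z ^+ N.+1)).
  by right; have [_ _ ->] := frac_small N vz; rewrite -mulr_natr natz; nia.
by move=> i /wz wzi; right; rewrite frac_large// -mulr_natr natz; nia.
Qed.

End Places.

(** * Places of a function field *)

Section FunctionFieldPlaces.
Variables (k : finFieldType) (F : fieldExtType {fraction {poly k}}).
Local Notation cst := (@const_in k F).
Implicit Types (w : place F) (x y z : F) (p : {poly k}).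

(** The constants satisfy c^q = c, so their valuation is 0. *)
Lemma place_const w c : w (cst c) = 0.
Proof.
have e : cst c ^+ #|k| = cst c by rewrite -rmorphXn /= expf_card.
have := placeX w (cst c) #|k|; rewrite e -mulr_natr natz.
have : (1 < #|k|)%N := finNzRing_gt1 k.
by move: (w (cst c)) #|k| => m q q1 /eqP; nia.
Qed.

Lemma vge0_const w c : vge w 0 (cst c).
Proof. by right; rewrite place_const. Qed.

Lemma ksub_vge w m : ksub cst [set x | vge w m x].
Proof.
split=> /= [|x y|c x]; [by left|exact: vgeD|].
by apply: vgeM (vge0_const w c); rewrite add0r.
Qed.

Definition peval y p : F := (map_poly cst p).[y].

Lemma pevalM y p q : peval y (p * q) = peval y p * peval y q.
Proof. by rewrite /peval rmorphM hornerM. Qed.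

Lemma peval_consX y p c : peval y (p * 'X + c%:P) = peval y p * y + cst c.
Proof. by rewrite /peval rmorphD rmorphM /= map_polyX map_polyC !hornerE. Qed.

Lemma peval_poly y (m : nat) (c : nat -> k) :
  peval y (\poly_(l < m) c l) = \sum_(l < m) cst (c l) * y ^+ l.
Proof.
rewrite /peval (@horner_coef_wide _ m); last first.
  by apply: leq_trans (size_poly _ _) _; apply: size_poly.
by apply: eq_bigr => l _; rewrite coef_map coef_poly ltn_ord.
Qed.

Lemma vge0_peval w y p : vge w 0 y -> vge w 0 (peval y p).
Proof.
move=> wy; elim/poly_ind: p => [|p c IH]; first by left; rewrite /peval rmorph0 horner0.
by rewrite peval_consX; apply: vgeD; [apply: vge0M|apply: vge0_const].
Qed.

Lemma peval_const_dominates w y p c : 0 < w y -> c != 0 ->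
  peval y (p * 'X + c%:P) != 0 /\ w (peval y (p * 'X + c%:P)) = 0.
Proof.
move=> wy c0; rewrite peval_consX addrC.
have [||? ->] := @placeD_lt _ w (cst c) (peval y p * y).
- by rewrite fmorph_eq0.
- apply: (@vgeM _ _ 0 1); first by rewrite place_const.
    by apply: vge0_peval; right; apply: ltW.
  by right; lia.
- by rewrite place_const.
Qed.

Lemma place_peval w y p : 0 < w y -> p != 0 ->
  peval y p != 0 /\ w (peval y p) + w y <= w y *+ size p.
Proof.
move=> wy; have y0 := place_gt0_neq0 wy.
elim/poly_ind: p => [|p c IH]; first by rewrite eqxx.
have [->|c0 _] := eqVneq c 0.
  rewrite size_MXaddC peval_consX (rmorph0 cst) !addr0 eqxx andbT.
  have [->|p0 _] := eqVneq p 0; first by rewrite mul0r eqxx.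
  have [q0 le] := IH p0; split; first by rewrite mulf_neq0.
  by rewrite place_valM// mulrSr lerD2r.
have [q0 ->] := peval_const_dominates p wy c0; split => //.
rewrite size_MXaddC (negPf c0) andbF add0r mulrS lerDl.
by rewrite -mulr_natr natz; nia.
Qed.

Lemma peval_inv_bound w y p (l : nat) : y != 0 -> w y <= 0 -> (size p <= l.+1)%N ->
  vge w 0 (peval y p / y ^+ l).
Proof.
move=> y0 wy sp; rewrite /peval (@horner_coef_wide _ l.+1); last first.
  by apply: leq_trans (size_poly _ _) sp.
rewrite mulr_suml; apply: vge_sum => i _; rewrite coef_map -mulrA.
apply: vge0M; first exact: vge0_const.
right; rewrite place_valM ?invr_eq0 ?expf_neq0// placeV !placeX.
by rewrite subr_ge0 ler_wnMn2l// -ltnS.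
Qed.

(** The element a_d x is integral over the valuation ring: if x had a large
    pole, the leading term could not be cancelled by the others. *)
Lemma valuation_ring_integral w (a : nat -> F) d x :
  (forall i, (i <= d)%N -> vge w 0 (a i)) -> a d != 0 ->
  \sum_(i < d.+1) a i * x ^+ i = 0 -> vge w 0 (a d * x).
Proof.
move=> va ad0 rel.
have [->|x0] := eqVneq x 0; first by left; rewrite mulr0.
have [|neg] := leP 0 (w (a d * x)); first by right.
have vd := vge_neq0 ad0 (va d (leqnn d)).
have wx : w x < 0 by move: neg; rewrite place_valM//; lia.
case: d va ad0 rel neg vd => [|d] va ad0 rel neg vd.
  by move: rel; rewrite big_ord1 expr0 mulr1 => /eqP; rewrite (negPf ad0).
move: rel; rewrite big_ord_recr /= addrC => /eqP; rewrite addr_eq0 => /eqP rel.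
have : vge w (w x *+ d) (a d.+1 * x ^+ d.+1).
  rewrite rel; apply/vgeN/vge_sum => i _.
  apply: (@vgeM _ _ 0 (w x *+ d)); first by rewrite add0r.
    by apply: va; apply: ltnW.
  by right; rewrite placeX ler_wnMn2l ?(ltW wx)// -ltnS.
move=> /(vge_neq0 (mulf_neq0 ad0 (expf_neq0 _ x0))).
rewrite place_valM ?expf_neq0// placeX mulrS.
by move: neg; rewrite place_valM//; lia.
Qed.

(** Multiply u by the leading coefficient of an algebraic equation for u over
    k[y]. The product is integral over k[y]; after dividing the equation by a
    power of y, it becomes one over k[1/y]. This controls the poles of the
    multiple at the places where y, respectively 1/y, is regular. *)
Lemma integral_multiple (v : place F) y u : 0 < v y ->
  exists2 p : {poly k}, p != 0 & exists l : nat, forall w,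
    (0 <= w y -> vge w 0 (peval y p * u)) /\
    (w y <= 0 -> vge w 0 (peval y p / y ^+ l * u)).
Proof.
move=> vy; have y0 := place_gt0_neq0 vy.
have [d Hd] := poly_dependence y 1.
have [p0 [i0 i0d pi0] Hp0] := Hd (fun i _ => u ^+ i).
have {Hp0} rel0 := Hp0 0%N isT.
pose P i := (i <= d)%N && (p0 i != 0).
have exP : exists i, P i by exists i0; rewrite /P i0d.
have ubP i : P i -> (i <= d)%N by case/andP.
case: (ex_maxnP exP ubP) => e /andP[ed pe0] maxe.
have rel : \sum_(i < e.+1) peval y (p0 i) * u ^+ i = 0.
  apply: etrans rel0.
  rewrite (big_ord_widen _ (fun i => peval y (p0 i) * u ^+ i) (_ : e.+1 <= d.+1)%N)//.
  rewrite big_mkcond; apply: eq_bigr => i _; case: ifPn => //; rewrite -leqNgt => ei.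
  have [->|ne] := eqVneq (p0 i) 0; first by rewrite rmorph0 horner0 mul0r.
  by move: (maxe i); rewrite /P ne -ltnS ltn_ord => /(_ isT); rewrite leqNgt ei.
exists (p0 e) => //.
pose l := (\max_(i < e.+1) size (p0 i))%N; exists l => w.
have sl i : (i <= e)%N -> (size (p0 i) <= l.+1)%N.
  move=> ie; apply: leqW.
  exact: (@leq_bigmax _ (fun i : 'I_e.+1 => size (p0 i)) (Ordinal (ie : (i < e.+1)%N))).
split=> wy.
  apply: (@valuation_ring_integral w (fun i => peval y (p0 i)) e) => //.
    by move=> i _; apply: vge0_peval; right.
  by case: (place_peval vy pe0).
apply: (@valuation_ring_integral w (fun i => peval y (p0 i) / y ^+ l) e) => //.
- by move=> i /sl; apply: peval_inv_bound.
- rewrite mulf_neq0 ?invr_eq0 ?expf_neq0//.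
  by case: (place_peval vy pe0).
- under eq_bigr do rewrite mulrAC.
  by rewrite -mulr_suml rel mul0r.
Qed.

(** Approximation provides elements e_i that are 1 modulo the i-th place and 0
    modulo the others. They are independent modulo y over k in the
    intersection of the valuation rings, so their number is bounded. *)
Lemma distinct_zeros_bounded y : exists n, forall (ws : nat -> place F) s,
  (forall i, (i < s)%N -> 0 < ws i y) ->
  (forall i j, (i < s)%N -> (j < s)%N -> i != j -> ~ (ws i =1 ws j)) -> (s <= n)%N.
Proof.
have [d Hd] := poly_dependence y 1; exists d.+1 => ws s pos dist.
rewrite leqNgt; apply/negP => ds.
have si i : (i <= d.+1)%N -> (i < s)%N by move=> id; apply: leq_ltn_trans ds.
have y0 : y != 0 by apply: (@place_gt0_neq0 _ (ws 0%N)); apply: pos; apply: si.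
have /choice [e He] : forall i, exists e, (i <= d.+1)%N ->
    vge (ws i) 1 (1 - e) /\ forall j, (j <= d.+1)%N -> j != i -> vge (ws j) 1 e.
  move=> i; have [id|_] := boolP (i <= d.+1)%N; last by exists 0.
  have [|e e1 e2] := @weak_approximation _ (ws i) (fun j => ws (bump i j)) d.+1 1.
    move=> j jd; apply: dist; rewrite ?si//.
      by rewrite /bump; case: (i <= j)%N; rewrite ?add1n ?add0n// ltnW.
    by rewrite eq_sym neq_bump.
  exists e => _; split=> // j jd ji.
  have := e2 (unbump i j); rewrite unbumpKcond (negPf ji) add0n; apply.
  by rewrite /unbump; case: ltngtP ji => //; lia.
pose M := [set x : F | forall i, (i <= d.+1)%N -> vge (ws i) 0 x].
have sM : ksub cst M.
  split=> /= [i _|x z Mx Mz i id|c x Mx i id]; first by left.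
    by apply: vgeD; [apply: Mx|apply: Mz].
  by apply: vge0M; [apply: vge0_const|apply: Mx].
have yM z : M z -> M (y * z).
  move=> Mz i id; apply: vge0M; last exact: Mz.
  by right; apply/ltW/pos/si.
have dep : kdep cst M (scaled y M) d.
  apply: kdep_of_relation => // z _.
  have [p p0 Hp] := Hd (fun i _ => z i); exists p => //; exact: (Hp 0%N).
have eM i : (i <= d)%N -> M (e i).
  move=> id j jd; have [e1 e2] := He i (leqW id).
  have [->|ji] := eqVneq j i; last by apply: (@vge_le _ _ 0 1) => //; apply: e2.
  rewrite -[e i](subKr 1); apply: vgeB; first exact: vge1.
  exact: (@vge_le _ _ 0 1).
have [c [j jd cj] [m Mm eqm]] := dep e eM.
have jd1 := leqW jd.
have : vge (ws j) 1 (cst (c j)).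
  have [e1 e2] := He j jd1.
  have -> : cst (c j) = cst (c j) * (1 - e j) + (y * m -
      \sum_(i < d.+1 | i != Ordinal (jd : (j < d.+1)%N)) cst (c i) * e i).
    rewrite -eqm (bigD1 (Ordinal (jd : (j < d.+1)%N))) //= addrK.
    by rewrite -mulrDr subrK mulr1.
  apply: vgeD; first by apply: (@vgeM _ _ 0 1) => //; apply: vge0_const.
  apply: vgeB.
    apply: (@vgeM _ _ 1 0) => //; last exact: Mm.
    by right; have := pos j (si _ jd1); lia.
  apply: vge_sum => i ij; apply: (@vgeM _ _ 0 1) => //; first exact: vge0_const.
  have [_] := He i (ltnW (ltn_ord i)); apply => //.
  by apply: contraNneq ij => jE; apply/eqP/val_inj.
move=> /(vge_neq0 (_ : cst (c j) != 0)); rewrite fmorph_eq0 => /(_ cj).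
by rewrite place_const.
Qed.

Lemma finitely_many_zeros (v : place F) y : 0 < v y ->
  exists ws : nat -> place F, exists s,
    (forall i, (i < s)%N -> ~ (ws i =1 v)) /\
    forall w, 0 < w y -> ~ (w =1 v) -> exists2 i, (i < s)%N & w =1 ws i.
Proof.
move=> vy; have [n Hn] := distinct_zeros_bounded y.
pose P s := `[< exists ws : nat -> place F, [/\ forall i, (i <= s)%N -> 0 < ws i y,
  forall i j, (i <= s)%N -> (j <= s)%N -> i != j -> ~ (ws i =1 ws j) & ws 0%N = v] >].
have exP : exists s, P s.
  exists 0%N; apply/asboolP; exists (fun=> v); split=> // i j.
  by rewrite !leqn0 => /eqP -> /eqP ->.
have ubP s : P s -> (s <= n)%N.
  move=> /asboolP[ws [pos dist _]]; apply: ltnW; apply: (Hn ws) => [i|i j]; rewrite !ltnS.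
    exact: pos.
  exact: dist.
case: (ex_maxnP exP ubP) => s /asboolP[ws [pos dist wsv]] maxs.
exists (fun i => ws i.+1), s; split=> [i si h|w wy wv].
  by apply: (dist i.+1 0%N); rewrite ?wsv.
apply: contrapT => nex.
have nws i : (i <= s)%N -> ~ (w =1 ws i).
  by case: i => [_|i si h]; [rewrite wsv|apply: nex; exists i].
suff : P s.+1 by move/maxs; rewrite ltnn.
apply/asboolP; exists (fun i => if (i <= s)%N then ws i else w); split=> //.
  by move=> i _; case: ifP => // /pos.
move=> i j i1 j1 ij; case: ifPn => si; case: ifPn => sj.
- exact: dist.
- by move=> h; apply: (nws i si) => x; rewrite h.
- exact: nws.
- by case/eqP: ij; lia.
Qed.

End FunctionFieldPlaces.

(** * A function with its only pole at a given place *)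

Section PoleOnlyAtInfinity.
Variables (k : finFieldType) (F : fieldExtType {fraction {poly k}}).
Variable infty : place F.
Local Notation cst := (@const_in k F).
Local Notation A := (regular_away infty).
Implicit Types (w : place F) (x y z : F) (p : {poly k}).

(** Take z with a pole at infty and zeros at the other zeros of x, and a
    polynomial g such that g(x) z is integral over k[1/x] up to a power of x;
    one may assume that g(0) <> 0. Away from infty, x has no poles, so this
    multiple is regular where x is a unit, and it is regular at the zeros of x
    by the choice of z. At infty the factor g(x) is a unit. *)
Lemma regular_zero_gives_pole x : A x -> 0 < infty x ->
  exists2 a, A a & infty a < 0.
Proof.
move=> Ax vx; have x0 := place_gt0_neq0 vx.
have [ws [s [ne zeros]]] := finitely_many_zeros vx.
have [z vz wz] := separate_places ne.
have z0 := place_lt0_neq0 vz.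
have [p p0 [l Hp]] := integral_multiple z vx.
have [g [m [pE g0]]] : exists g m, p = g * 'X^m /\ g`_0 != 0.
  move: p0; clear Hp; elim/poly_ind: p => [|p c IH]; first by rewrite eqxx.
  have [->|c0 _] := eqVneq c 0; last first.
    exists (p * 'X + c%:P), 0%N; rewrite expr0 mulr1; split=> //.
    by rewrite coefD coefMX coefC /= add0r.
  rewrite addr0; have [->|/IH [g [m [-> g0]]] _] := eqVneq p 0; first by rewrite mul0r eqxx.
  by exists g, m.+1; rewrite exprSr mulrA.
have [q gE] : exists q, g = q * 'X + (g`_0)%:P.
  elim/poly_ind: (g) => [|q c _]; first by exists 0; rewrite mul0r coef0 addr0.
  by exists q; rewrite coefD coefMX coefC /= add0r.
have [gx0 vgx] : peval x g != 0 /\ infty (peval x g) = 0.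
  by rewrite gE; apply: peval_const_dominates.
exists (peval x g * z); last by rewrite place_valM// vgx add0r.
move=> w nw; have [x0'|wx] := Ax w nw; first by move: x0; rewrite x0' eqxx.
move: wx; rewrite le_eqVlt => /predU1P[wx|wx].
  have [_] := Hp w; rewrite -wx lexx => /(_ isT).
  rewrite pE pevalM (_ : peval x 'X^m = x ^+ m); last first.
    by rewrite /peval map_polyXn hornerXn.
  move=> h.
  have -> : peval x g * z = (peval x g * x ^+ m / x ^+ l * z) * (x ^+ l / x ^+ m).
    by field; rewrite !expf_neq0.
  apply: vge0M => //; right.
  by rewrite place_valM ?invr_eq0 ?expf_neq0// placeV !placeX -wx !mul0rn subrr.
have [i si wsi] := zeros w wx nw.
apply: vge0M; first by apply: vge0_peval; right; apply: ltW.
by right; rewrite wsi; apply/ltW/wz.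
Qed.

Lemma separating_element y (m : nat) : 0 < infty y -> exists2 e,
  vge infty m%:Z (1 - e) &
  forall w, ~ (w =1 infty) -> 0 < w y -> vge w (w y *+ m) e.
Proof.
move=> vy; have [ws [s [ne zeros]]] := finitely_many_zeros vy.
pose N := ((\max_(i < s) `|ws i y|) * m)%N.
have [e e1 e2] := weak_approximation (m + N) ne.
exists e; first by apply: vge_le e1; rewrite lez_nat leq_addr.
move=> w nw wy; have [i si wsi] := zeros w wy nw.
have : vge w (m + N)%N e.
  by case: (e2 i si) => h; [left|right; rewrite wsi].
apply: vge_le; rewrite wsi -mulr_natr natz.
have : (`|ws i y| <= \max_(i < s) `|ws i y|)%N.
  exact: (@leq_bigmax _ (fun i : 'I_s => `|ws i y|%N) (Ordinal si)).
rewrite /N; move: (\max_(_ < _) _)%N (ws i y) => M v vM.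
have {vM} : v <= M%:Z by lia.
move=> /(ler_wpM2r (isT : 0 <= m%:Z)) /le_trans; apply.
by rewrite -PoszM lez_nat leq_addl.
Qed.

End PoleOnlyAtInfinity.

Section ExistsPole.
Variables (k : finFieldType) (F : fieldExtType {fraction {poly k}}).
Variable infty : place F.
Local Notation cst := (@const_in k F).
Local Notation A := (regular_away infty).
Implicit Types (w : place F) (x y z : F) (p : {poly k}).

(** Suppose that there is no such function. Let y be a uniformiser at infty and
    let n be the dimension of F over k(y). Take n independent elements u_i of F
    that are integral over k[1/y] up to a power of y, and the span V of the
    u_i y^l / y^m for l < m', where m - m' is fixed: V has dimension n m', and
    its elements have poles only at the zeros of y, of order at most that of
    y^m. The principal parts of such functions form a space of dimension at
    most n m, of which at least m dimensions are taken by the principal parts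
    at infty. So all but n m - m dimensions of V consist of functions regular
    at the other zeros of y, thus of functions in A. By assumption these have
    no pole at infty, and no zero there either by [regular_zero_gives_pole], so
    that reduction modulo y embeds them in a space of dimension n. This gives
    n m' <= n m - m + n, which fails for large m. *)
Lemma exists_pole : exists2 a, A a & infty a < 0.
Proof.
apply: contrapT => nopole.
have Age a : A a -> vge infty 0 a.
  move=> Aa; right; rewrite leNgt; apply/negP => va.
  by apply: nopole; exists a.
have Azero a : A a -> vge infty 1 a -> a = 0.
  move=> Aa va; apply/eqP; apply: contraPT nopole => a0; apply.
  apply: (regular_zero_gives_pole Aa).
  by have := vge_neq0 a0 va; lia.
have [y y0 vy] := place_val_uniformiser infty.
have vy0 : 0 < infty y by rewrite vy.
pose dep n := `[< forall z : nat -> F, exists2 p : nat -> {poly k},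
  exists2 i, (i <= n)%N & p i != 0 & \sum_(i < n.+1) peval y (p i) * z i = 0 >].
have exdep : exists n, dep n.
  have [d Hd] := poly_dependence y 1; exists d; apply/asboolP => z.
  by have [p p0 Hp] := Hd (fun i _ => z i); exists p => //; apply: (Hp 0%N).
case: (ex_minnP exdep) => n /asboolP depn minn.
have quot M : ksub cst M -> (forall x, M x -> M (y * x)) -> kdep cst M (scaled y M) n.
  by move=> sM yM; apply: kdep_of_relation => // z _; apply: depn.
have sO : ksub cst [set x | vge infty 0 x] := ksub_vge infty 0.
have yO x : [set x | vge infty 0 x] x -> [set x | vge infty 0 x] (y * x).
  by move=> /= vx; apply: vge0M => //; right; rewrite vy.
case: n depn minn quot => [|n] depn minn quot.
  have [|c [i]] := quot _ sO yO (fun=> 1); first by move=> i _; apply: vge1.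
  rewrite leqn0 => /eqP -> c0 [x /= vx]; rewrite big_ord1 mulr1 => e.
  have : vge infty 1 (cst (c 0%N)).
    by rewrite e; apply: (@vgeM _ _ 1 0) => //; right; rewrite vy.
  by move=> /(vge_neq0 (_ : cst (c 0%N) != 0)); rewrite fmorph_eq0 => /(_ c0); rewrite place_const.
(* As n is minimal, there are n elements independent over k[y]. *)
have [z indz] : exists z : nat -> F, forall p : nat -> {poly k},
    \sum_(i < n.+1) peval y (p i) * z i = 0 -> forall i, (i <= n)%N -> p i = 0.
  have /asboolPn/existsNP [z nz] : ~~ dep n by apply/negP => /minn; rewrite ltnn.
  exists z => p Hp i id; apply/eqP; apply: contraPT nz => pi; apply.
  by exists p => //; exists i.
have /choice [P HP] : forall i, exists pl : {poly k} * nat, pl.1 != 0 /\ forall w,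
    (0 <= w y -> vge w 0 (peval y pl.1 * z i)) /\
    (w y <= 0 -> vge w 0 (peval y pl.1 / y ^+ pl.2 * z i)).
  by move=> i; have [p p0 [l H]] := integral_multiple (z i) vy0; exists (p, l).
(* The choice of m' makes n m' exceed n m - m + n (with n.+1 in place of n). *)
pose c := (\max_(i < n.+1) (P i).2)%N.
pose m' := (n.+1 * c + n.+1 + 1)%N; pose m := (c + m')%N.
pose fam (il : 'I_n.+1 * 'I_m') := peval y (P il.1).1 * z il.1 * y ^+ il.2 / y ^+ m.
have fam1 w il : w y <= 0 -> vge w 0 (fam il).
  case: il => i l wy; have [_] := (HP i).2 w; move=> /(_ wy) h.
  have -> : fam (i, l) = (peval y (P i).1 / y ^+ (P i).2 * z i) * (y ^+ ((P i).2 + l) / y ^+ m).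
    by rewrite /fam exprD; field; rewrite !expf_neq0.
  apply: vge0M => //; right.
  rewrite place_valM ?invr_eq0 ?expf_neq0// placeV !placeX subr_ge0 ler_wnMn2l//.
  rewrite leq_add// ?(ltnW (ltn_ord l))//.
  exact: (@leq_bigmax _ (fun i : 'I_n.+1 => (P i).2)).
have fam2 w il : 0 < w y -> vge w 0 (y ^+ m * fam il).
  case: il => i l wy; have [+ _] := (HP i).2 w; move=> /(_ (ltW wy)) h.
  have -> : y ^+ m * fam (i, l) = peval y (P i).1 * z i * y ^+ l.
    by rewrite /fam; field; rewrite !expf_neq0.
  by apply: vge0M => //; apply: vge0X; right; apply: ltW.
pose V := [set x | exists c : 'I_n.+1 * 'I_m' -> k, x = \sum_il cst (c il) * fam il].
have sV : ksub cst V.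
  split.
  - by exists (fun=> 0); rewrite big1 // => il _; rewrite (rmorph0 cst) mul0r.
  - move=> _ _ [c1 ->] [c2 ->]; exists (fun il => c1 il + c2 il).
    by rewrite -big_split; apply: eq_bigr => il _; rewrite (rmorphD cst) mulrDl.
  - move=> a _ [c1 ->]; exists (fun il => a * c1 il).
    by rewrite mulr_sumr; apply: eq_bigr => il _; rewrite (rmorphM cst) mulrA.
have Vfam il : V (fam il).
  exists (fun jl => (jl == il)%:R); rewrite (bigD1 il) //= eqxx rmorph1 mul1r big1 ?addr0//.
  by move=> jl /negPf ->; rewrite (rmorph0 cst) mul0r.
have V1 w x : w y <= 0 -> V x -> vge w 0 x.
  move=> wy [a ->]; apply: vge_sum => il _.
  by apply: vge0M; [apply: vge0_const|apply: fam1].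
have V2 w x : 0 < w y -> V x -> vge w 0 (y ^+ m * x).
  move=> wy [a ->]; rewrite mulr_sumr; apply: vge_sum => il _; rewrite mulrCA.
  by apply: vge0M; [apply: vge0_const|apply: fam2].
have V3 (a : 'I_n.+1 * 'I_m' -> k) : \sum_il cst (a il) * fam il = 0 -> forall il, a il = 0.
  move=> a0.
  pose q (i : nat) := \poly_(l < m') (if insub i is Some i' then
     (if insub l is Some l' then a (i', l') else 0) else 0).
  have qE (i : 'I_n.+1) : peval y (q i) = \sum_(l < m') cst (a (i, l)) * y ^+ l.
    by rewrite /q peval_poly valK; apply: eq_bigr => l _; rewrite valK.
  have : \sum_(i < n.+1) peval y (q i * (P i).1) * z i = 0.
    rewrite -[LHS](mulfVK (_ : y ^+ m != 0)) ?expf_neq0// [X in X * _](_ : _ = 0) ?mul0r//.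
    transitivity (\sum_il cst (a (il.1, il.2)) * fam (il.1, il.2)); last first.
      by apply: etrans a0; apply: eq_bigr => -[].
    rewrite -(pair_bigA _ (fun i l => cst (a (i, l)) * fam (i, l))) /= mulr_suml.
    apply: eq_bigr => i _; rewrite pevalM qE !mulr_suml; apply: eq_bigr => l _.
    by rewrite /fam /=; field; rewrite expf_neq0.
  move=> /(indz (fun i => q i * (P i).1)) qP [i l].
  have : q i = 0.
    have := qP i; rewrite -ltnS ltn_ord => /(_ isT) /eqP; rewrite mulf_eq0.
    by have [/negPf -> _] := HP i; rewrite orbF => /eqP.
  by move/polyP/(_ l); rewrite coef_poly ltn_ord coef0 !valK.
(* R is the ring of functions regular at the zeros of y, and S j = y^-j R. *)
pose R := [set x : F | forall w, 0 < w y -> vge w 0 x].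
pose S j := [set x : F | R (y ^+ j * x)].
have sR : ksub cst R.
  split=> /= [w _|x x' Rx Rx' w wy|a x Rx w wy]; first by left.
    by apply: vgeD; [apply: Rx|apply: Rx'].
  by apply: vge0M; [apply: vge0_const|apply: Rx].
have RM x x' : R x -> R x' -> R (x * x').
  by move=> Rx Rx' w wy; apply: vge0M; [apply: Rx|apply: Rx'].
have Ry : R y by move=> w wy; right; apply: ltW.
have sS j : ksub cst (S j).
  case: sR => R0 RD RZ; split=> /= [|x x' Rx Rx'|a x Rx].
  - by rewrite /S /= mulr0.
  - by rewrite /S /= mulrDr; apply: RD.
  - by rewrite /S /= mulrCA; apply: RZ.
have Sstep j : kspan cst (S j.+1) (S j) n.+1.
  have [b Rb spn] := kdep_kspan sR (ksub_scaled y sR) (quot _ sR (fun x => RM y x Ry)).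
  exists (fun i => b i / y ^+ j.+1) => [i /Rb|x /spn [a [r Rr ar]]].
    by rewrite /S /= mulrCA divff ?expf_neq0// mulr1.
  exists a; rewrite /S /=; congr R: Rr.
  apply: (mulfI y0); rewrite -ar mulrBr mulrBr mulrA -exprS; congr (_ - _).
  rewrite mulrA -exprS mulr_sumr; apply: eq_bigr => i _.
  by rewrite [RHS]mulrCA; congr (_ * _); rewrite mulrCA divff ?expf_neq0// mulr1.
have SS j x : S j x -> S j.+1 x by move=> Sx; rewrite /S /= exprS -mulrA; apply: RM.
have span j : kspan cst (S j) (S 0%N) (n.+1 * j).
  elim: j => [|j IH].
    by rewrite muln0; exists (fun=> 0) => // x Sx; exists (fun=> 0); rewrite big_ord0 subr0.
  by rewrite mulnS; apply: kspan_trans (Sstep j) IH => //; apply: SS.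
(* Multiplication by 1 - e removes the principal part at infty and keeps the
   principal parts at the other zeros of y. *)
have [e e1 e2] := separating_element m vy0.
have Re1 : R (1 - e).
  move=> w wy; have [wv|nw] := EM (w =1 infty).
    by case: e1 => [->|h]; [left|right; rewrite wv; apply: le_trans h].
  apply: vgeB; first exact: vge1.
  by apply: vge_le (e2 w nw wy); rewrite mulrn_wge0// ltW.
have Re : R e by rewrite -[e](subKr 1); apply: (ksubB sR) => // w _; apply: vge1.
pose Ker := [set x | V x /\ R ((1 - e) * x)].
have sKer : ksub cst Ker.
  case: sV sR => V0 VD VZ [R0 RD RZ]; split=> /= [|x x' [Vx Rx] [Vx' Rx']|a x [Vx Rx]].
  - by split=> //; rewrite mulr0.
  - by split; [apply: VD|rewrite mulrDr; apply: RD].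
  - by split; [apply: VZ|rewrite mulrCA; apply: RZ].
have KerA x : Ker x -> A x.
  move=> [Vx Rx] w nw; have [wy|wy] := leP (w y) 0; first exact: V1 Vx.
  rewrite -[x]mul1r -(subrK e 1) mulrDl; apply: vgeD; first exact: Rx.
  have -> : e * x = e / y ^+ m * (y ^+ m * x) by rewrite mulrA mulfVK ?expf_neq0.
  apply: vge0M; last exact: V2.
  apply: (vgeM _ (e2 w nw wy) (vge_refl w _)).
  by rewrite placeV placeX subrr.
have inf0 x : V x -> vge infty 0 ((1 - e) * x).
  move=> Vx.
  have -> : (1 - e) * x = (1 - e) / y ^+ m * (y ^+ m * x) by rewrite mulrA mulfVK ?expf_neq0.
  apply: vge0M; last exact: V2.
  apply: (vgeM _ e1 (vge_refl infty _)).
  by rewrite placeV placeX vy natz subrr.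
have m0 : (0 < m)%N by rewrite /m /m' addn1 addnS.
have [e0 ve] : e != 0 /\ infty e = 0.
  rewrite -[e](subKr 1).
  have [|? ->] := @placeD_lt _ infty 1 (- (1 - e)) (oner_neq0 _); last by rewrite place1.
  by rewrite place1; apply: vgeN; apply: vge_le e1; rewrite add0r lez_nat.
have VKer : kspan cst V Ker (n.+1 * m - m).
  apply: kdep_kspan => // x Vx.
  (* To elements of V with their principal parts at infty removed, add m
     functions with independent principal parts at infty only. *)
  pose f (t : 'I_(n.+1 * m - m).+1 + 'I_m) := match t with
    | inl i => (1 - e) * x i | inr j => e * (y ^+ j / y ^+ m) end.
  have [||a [t at0] Ha] := kspan_family (y := f) (sS 0%N) (span m).
  - by rewrite card_sum !card_ord addSn subnK// leq_pmull.
  - case=> [i|j]; rewrite /S /f /=.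
      rewrite mulrCA; apply: RM => // w wy; apply: V2 => //; apply: Vx.
      by rewrite -ltnS.
    rewrite mulrCA; apply: RM => //.
    by rewrite mulrC mulfVK ?expf_neq0// => w wy; apply: vge0X; right; apply: ltW.
  move: Ha; rewrite big_sumType /= /S /= expr0 mul1r => Ha.
  pose q := \poly_(j < m) (if insub j is Some j' then a (inr j') else 0).
  have qE : \sum_(j < m) cst (a (inr j)) * (e * (y ^+ j / y ^+ m)) = e * (peval y q / y ^+ m).
    rewrite /q peval_poly mulr_suml mulr_sumr; apply: eq_bigr => j _.
    by rewrite valK mulrCA !mulrA.
  have R1 : vge infty 0 (e * (peval y q / y ^+ m)).
    rewrite -qE -[X in vge _ _ X](addKr (\sum_i cst (a (inl i)) * ((1 - e) * x i))).
    apply: vgeD; last exact: Ha.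
    apply/vgeN/vge_sum => i _; apply: vge0M; first exact: vge0_const.
    by apply/inf0/Vx; rewrite -ltnS.
  have q0 : q = 0.
    apply/eqP; apply: contraT => q0; have [pq0 le] := place_peval vy0 q0.
    have := vge_neq0 _ R1.
    rewrite !mulf_neq0 ?invr_eq0 ?expf_neq0// => /(_ isT).
    rewrite !place_valM ?mulf_neq0 ?invr_eq0 ?expf_neq0// ve placeV placeX.
    have : (size q <= m)%N := size_poly _ _.
    by move: le; rewrite vy !natz; move: (infty _) (size q) => v s; lia.
  have ar j : a (inr j) = 0.
    by move/polyP/(_ j): q0; rewrite coef_poly ltn_ord coef0 valK.
  exists (fun i => if insub i is Some i' then a (inl i') else 0).
    case: t at0 => [i ai|j]; last by rewrite ar eqxx.
    by exists i; rewrite ?valK// -ltnS.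
  under eq_bigr do rewrite valK.
  split; first by apply: (ksub_sum _ sV) => i _; case: sV => _ _; apply; apply: Vx; rewrite -ltnS.
  rewrite mulr_sumr; congr R: Ha; rewrite qE q0 /peval (rmorph0 (map_poly cst)) horner0 mul0r mulr0 addr0.
  by apply: eq_bigr => i _; rewrite mulrCA.
have Ker0 : kspan cst Ker [set 0] n.+1.
  have s0 : ksub cst [set 0] by split=> /= [|x x' -> ->|a x ->]; rewrite ?addr0 ?mulr0.
  apply: kdep_kspan => // x Kx.
  have [|a a0 [r vr ar]] := quot _ sO yO x; first by move=> i /Kx/KerA/Age.
  exists a => //=; apply: Azero.
    by apply: KerA; apply: (ksub_sum _ sKer) => i _; case: sKer => _ _; apply; apply: Kx; rewrite -ltnS.
  by rewrite ar; apply: (@vgeM _ _ 1 0) => //; right; rewrite vy.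
have s0 : ksub cst [set 0] by split=> /= [|x x' -> ->|a x ->]; rewrite ?addr0 ?mulr0.
have := kspan_trans sV (fun x (Kx : Ker x) => Kx.1) VKer Ker0.
move=> /(kspan_family (y := fam) s0)[]//.
  rewrite card_prod !card_ord mulSn addKn /m mulnDr mulSn.
  by rewrite /m'; lia.
by move=> a [il /eqP ail] /= /V3 a0; apply: ail.
Qed.

End ExistsPole.

(** * Invertibility of ideals *)

Section InvertibleIdeals.
Variables (F : fieldType) (A : set F).
Hypotheses (A1 : A 1) (AB : forall x y, A x -> A y -> A (x - y))
  (AM : forall x y, A x -> A y -> A (x * y)).
Hypothesis A_closed : forall d x, d != 0 -> (forall n : nat, A (d * x ^+ n)) -> A x.
Hypothesis A_finite : forall x, A x -> x != 0 -> exists (T : finType) (s : T -> F),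
  (forall t, A (s t)) /\ forall y, A y -> exists t, scaled x A (y - s t).

Let A0 : A 0. Proof. by rewrite -(subrr 1); apply: AB. Qed.

Definition is_ideal (I : set F) := [/\ I 0, forall x y, I x -> I y -> I (x + y),
  forall a x, A a -> I x -> I (a * x) & forall x, I x -> A x].

Let idealB I x y : is_ideal I -> I x -> I y -> I (x - y).
Proof.
case=> _ ID IM _ Ix Iy; apply: ID => //; rewrite -mulN1r; apply: IM => //.
by rewrite -[-1]sub0r; apply: AB.
Qed.

Let AN x : A x -> A (- x). Proof. by rewrite -sub0r; apply: AB. Qed.
Let AD x y : A x -> A y -> A (x + y).
Proof. by move=> Ax /AN; rewrite -{2}[y]opprK; apply: AB. Qed.
Let AX x n : A x -> A (x ^+ n).
Proof. by move=> Ax; elim: n => [|n IH]; rewrite ?expr0// exprS; apply: AM. Qed.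

Let ideal_scaled x : A x -> is_ideal (scaled x A).
Proof.
move=> Ax; split.
- by exists 0 => //; rewrite mulr0.
- by move=> _ _ [u Au ->] [v Av ->]; exists (u + v); [exact: AD|rewrite mulrDr].
- by move=> a _ Aa [u Au ->]; exists (a * u); [exact: AM|rewrite mulrCA].
- by move=> _ [u Au ->]; apply: AM.
Qed.

(** It suffices to find y in A outside x A with I y contained in x A, since then
    g = y / x works. Call y good if no c with c y in x A is congruent to 1
    modulo I. A good y is not in x A, and 1 is good. For p in I, the powers
    p^n y cannot all be good: two of them agree modulo x, and then 1 - p^m
    annihilates one of them modulo x. At the last power up to which all are good, some c
    congruent to 1 modulo I kills p^(n+1) y modulo x, and c p^n y is a good
    element killed by p modulo x. Treating representatives of I modulo x one after the other
    gives the result. *)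
Lemma proper_ideal_inverse I x : is_ideal I -> I x -> x != 0 -> ~ I 1 ->
  exists2 g, ~ A g & forall z, I z -> A (g * z).
Proof.
move=> iI Ix x0 nI1; case: (iI) => I0 ID IM IA.
have Ax := IA x Ix.
have [xA0 xAD xAM _] := ideal_scaled Ax.
have [T [s [As reps]]] := A_finite Ax x0.
pose good y := A y /\ forall c, A c -> scaled x A (c * y) -> ~ I (1 - c).
have kill p y : I p -> good y -> exists y', [/\ good y', scaled x A (p * y')
    & forall p', scaled x A (p' * y) -> scaled x A (p' * y')].
  move=> Ip [Ay gy]; have Ap := IA p Ip.
  have /choice [f Hf] : forall n : nat, exists t, scaled x A (p ^+ n * y - s t).
    by move=> n; apply: reps; apply: AM => //; apply: AX.
  have [n nbad] : exists n, `[< ~ good (p ^+ n * y) >].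
    have [i [j [ij fij]]] : exists i j : 'I_#|T|.+1, i != j /\ f i = f j.
      apply: contrapT => h; have : injective (fun i : 'I_#|T|.+1 => f i).
        move=> i j fij; apply/eqP; apply: contraPT h => ij; apply.
        by exists i, j.
      by move=> /leq_card; rewrite card_ord ltnn.
    wlog lij : i j ij fij / (i < j)%N.
      move=> W; move: (ij); rewrite -val_eqE neq_ltn => /orP[] l; first exact: (W i j).
      by apply: (W j i); rewrite // eq_sym.
    exists i; apply/asboolP => -[_ /(_ (1 - p ^+ (j - i)))] H.
    apply: H; first by apply: AB => //; apply: AX.
      have -> : (1 - p ^+ (j - i)) * (p ^+ i * y) =
          (p ^+ i * y - s (f i)) - (p ^+ j * y - s (f j)).
        rewrite fij opprB addrA subrK mulrBl mul1r mulrA -exprD subnK//; exact: ltnW.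
      by apply: idealB => //; exact: ideal_scaled.
    rewrite opprB addrC subrK -(prednK (_ : 0 < j - i)%N) ?subn_gt0// exprSr.
    by apply: IM => //; apply: AX.
  have exbad : exists n, `[< ~ good (p ^+ n * y) >] by exists n.
  case: (ex_minnP exbad) => -[|m] /asboolP bad minm.
    by case: bad; rewrite expr0 mul1r.
  have [Am gm] : good (p ^+ m * y).
    apply: contrapT => h; have := minm m; rewrite ltnn => H; exact: notF (H (asboolT h)).
  have [c [Ac cx Ic]] : exists c, [/\ A c, scaled x A (c * (p ^+ m.+1 * y)) & I (1 - c)].
    apply: contrapT => h; apply: bad; split; first by apply: AM => //; apply: AX.
    by move=> c Ac cx Ic; apply: h; exists c.
  exists (c * (p ^+ m * y)); split.
  - split; first exact: AM.
    move=> d Ad; rewrite mulrA => dc Id; apply: (gm (d * c)) => //; first exact: AM.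
    have -> : 1 - d * c = (1 - d) + d * (1 - c) by rewrite mulrBr mulr1 addrA subrK.
    by apply: ID => //; apply: IM.
  - by rewrite mulrCA [p * (_ * _)]mulrA -exprS.
  - move=> p' p'y; rewrite (_ : _ * _ = c * p ^+ m * (p' * y)).
      by apply: xAM => //; apply: AM => //; apply: AX.
    by ring.
have [y [[Ay gy] yI]] : exists y, good y /\ forall t, I (s t) -> scaled x A (s t * y).
  have : exists y, good y /\ forall t, t \in enum T -> I (s t) -> scaled x A (s t * y).
    elim: (enum T) => [|t l [y [gy yl]]].
      exists 1; split=> //; split=> // c Ac; rewrite mulr1 => -[u Au ->] h.
      apply: nI1; rewrite -(subrK (x * u) 1); apply: ID => //.
      by rewrite mulrC; apply: IM.
    have [It|nIt] := EM (I (s t)); last first.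
      by exists y; split=> // t'; rewrite inE => /predU1P[->//|]; apply: yl.
    have [y' [gy' ty' ly']] := kill _ _ It gy.
    exists y'; split=> // t'; rewrite inE => /predU1P[->//|t'l] It'.
    exact/ly'/yl.
  by move=> [y [gy yI]]; exists y; split=> // t; apply: yI; rewrite mem_enum.
exists (y / x).
  move=> Ayx; apply: (gy 1 A1); last by rewrite subrr.
  by rewrite mul1r; exists (y / x) => //; rewrite mulrC mulfVK.
move=> z Iz; have [t [a Aa zt]] := reps z (IA z Iz).
have It : I (s t).
  rewrite (_ : s t = z - a * x); last by rewrite mulrC -zt opprB addrC subrK.
  by apply: idealB => //; apply: IM.
have [b Ab tb] := yI t It.
rewrite (_ : y / x * z = b + a * y); first by apply: AD => //; apply: AM.
rewrite -(subrK (s t) z) zt mulrDr addrC; congr (_ + _).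
  by rewrite mulrAC [y * _]mulrC tb mulrAC divff// mul1r.
by rewrite mulrA mulfVK// mulrC.
Qed.

Definition invertible (I : set F) := exists l : seq (F * F),
  (forall p, p \in l -> I p.1 /\ forall z, I z -> A (p.2 * z)) /\
  \sum_(p <- l) p.1 * p.2 = 1.

(** By induction on the number of classes modulo x outside I. If I is proper,
    take g outside A with g I contained in A. The ideal K = I + g I is larger
    than I, as otherwise x g^n would lie in I for all n and g would lie in A by
    complete integral closedness. An expression of 1 that shows K to be
    invertible expands into one for I. *)
Lemma ideal_invertible I x : is_ideal I -> I x -> x != 0 -> invertible I.
Proof.
move=> iI Ix x0; have Ax : A x by case: iI => _ _ _; apply.
have [T [s [As reps]]] := A_finite Ax x0.
pose mu (I : set F) := finset (fun t => `[< I (s t) >]).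
have [n] := ubnP (#|T| - #|mu I|); elim: n I iI Ix => // n IH I iI Ix mun.
case: (iI) => I0 ID IM IA.
have [I1|nI1] := EM (I 1).
  exists [:: (1, 1)]; rewrite big_seq1 mulr1; split=> // p; rewrite inE => /eqP ->.
  by split=> //= z Iz; rewrite mul1r; apply: IA.
have [g nAg gI] := proper_ideal_inverse iI Ix x0 nI1.
pose K : set F := [set z | exists2 u, I u & exists2 v, I v & z = u + g * v].
have iK : is_ideal K.
  split.
  - by exists 0 => //; exists 0; rewrite // mulr0 addr0.
  - move=> _ _ [u Iu [v Iv ->]] [u' Iu' [v' Iv' ->]]; exists (u + u'); first exact: ID.
    by exists (v + v'); [exact: ID|rewrite mulrDr addrACA].
  - move=> a _ Aa [u Iu [v Iv ->]]; exists (a * u); first exact: IM.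
    by exists (a * v); [exact: IM|rewrite mulrDr [a * (g * v)]mulrCA].
  - by move=> _ [u Iu [v Iv ->]]; apply: AD; [apply: IA|apply: gI].
have IK z : I z -> K z by move=> Iz; exists z => //; exists 0; rewrite // mulr0 addr0.
have [v Iv nIgv] : exists2 v, I v & ~ I (g * v).
  apply: contrapT => h; apply: nAg; apply: (A_closed x0) => m; apply: IA.
  elim: m => [|m Im]; first by rewrite mulr1.
  rewrite exprSr mulrA mulrC; apply: contrapT => h'; apply: h.
  by exists (x * g ^+ m).
have [t Kt nIt] : exists2 t, K (s t) & ~ I (s t).
  have Kgv : K (g * v) by exists 0 => //; exists v; rewrite // add0r.
  have [t [a Aa ta]] := reps (g * v) (gI v Iv).
  have Ixa : I (x * a) by rewrite mulrC; apply: IM.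
  exists t.
    rewrite (_ : s t = g * v - x * a); last by rewrite -ta opprB addrC subrK.
    by apply: idealB => //; apply: IK.
  move=> It; apply: nIgv; rewrite -(subrK (s t) (g * v)) ta.
  exact: ID.
have [|l [lK lE]] := IH K iK (IK x Ix).
  rewrite (leq_trans _ (mun : (_ <= n)%N))// ltn_sub2l//.
    by rewrite ltn_neqAle max_card andbT; apply/negP => /eqP h;
      have := subset_cardP h (fintype.subset_predT _) t; rewrite !finset.in_set => /asboolP.
  apply/proper_card/properP; split.
    by apply/fintype.subsetP => u; rewrite !finset.in_set => /asboolP Iu; apply/asboolP/IK.
  by exists t; rewrite finset.in_set; [apply/asboolP|apply/asboolPn].
have /choice [f Hf] : forall p : F * F, exists uv : F * F, p \in l ->
    [/\ I uv.1, I uv.2 & p.1 = uv.1 + g * uv.2].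
  move=> p; have [/lK[[u Iu [w Iw e]] _]|_] := boolP (p \in l); first by exists (u, w).
  by exists (0, 0).
exists ([seq ((f p).1, p.2) | p <- l] ++ [seq ((f p).2, g * p.2) | p <- l]); split.
  move=> q; rewrite mem_cat => /orP[] /mapP[p pl ->] /=.
    have [fp _ _] := Hf p pl; have [_ pK] := lK p pl.
    by split=> // z Iz; apply/pK/IK.
  have [_ fp _] := Hf p pl; have [_ pK] := lK p pl; split=> // z Iz.
  rewrite mulrAC mulrC; apply: pK.
  by exists 0 => //; exists z; rewrite // add0r.
rewrite big_cat !big_map /= -big_split /= -lE big_seq [RHS]big_seq.
apply: eq_bigr => p pl; have [_ _ ->] := Hf p pl.
by rewrite mulrDl mulrCA mulrA.
Qed.

End InvertibleIdeals.

(** * The ring of functions regular away from a place *)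

Section RegularFunctions.
Variables (k : finFieldType) (F : fieldExtType {fraction {poly k}}).
Variable infty : place F.
Local Notation cst := (@const_in k F).
Local Notation A := (regular_away infty).

Lemma regular1 : A 1.
Proof. by move=> w _; apply: vge1. Qed.

Lemma regularB x y : A x -> A y -> A (x - y).
Proof. by move=> Ax Ay w nw; apply: (@vgeB _ w 0); [apply: Ax|apply: Ay]. Qed.

Lemma regularM x y : A x -> A y -> A (x * y).
Proof. by move=> Ax Ay w nw; apply: (@vge0M _ w); [apply: Ax|apply: Ay]. Qed.

Lemma regular0 : A 0.
Proof. by rewrite -(subrr 1); apply: regularB; apply: regular1. Qed.

Lemma regularN1 : A (-1).
Proof. by rewrite -sub0r; apply: regularB; [apply: regular0|apply: regular1]. Qed.

Lemma regularD x y : A x -> A y -> A (x + y).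
Proof.
move=> Ax Ay; rewrite -[y]opprK; apply: regularB => //.
by rewrite -mulN1r; apply: regularM => //; apply: regularN1.
Qed.

Lemma regular_const c : A (cst c).
Proof. by move=> w _; apply: vge0_const. Qed.

(** A pole of x would give d x^n a pole for large n. *)
Lemma regular_completely_closed d x :
  d != 0 -> (forall n : nat, A (d * x ^+ n)) -> A x.
Proof.
move=> d0 dx w nw; have [->|x0] := eqVneq x 0; first by left.
right; rewrite leNgt; apply/negP => wx.
have := vge_neq0 (mulf_neq0 d0 (expf_neq0 `|w d|.+1 x0)) (dx _ w nw).
rewrite place_valM ?expf_neq0// placeX -mulr_natr natz.
by move: (w d) (w x) wx => a b; nia.
Qed.

Lemma regular_finite_quotient x : A x -> x != 0 -> exists (T : finType) (s : T -> F),
  (forall t, A (s t)) /\ forall y, A y -> exists t, scaled x A (y - s t).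
Proof.
move=> Ax x0; have [d Hd] := @module_quotient_kdep k F F idfun x 1 x0.
have sA : ksub (idfun \o cst) A.
  split=> [|y z|c y Ay]; [exact: regular0|exact: regularD|].
  by apply: regularM => //; apply: regular_const.
have dep : kdep (idfun \o cst) A (scaled x A) d.
  apply: (Hd A (fun=> 1) sA) => [y Ay|y Ay]; first exact: regularM.
  by exists (fun=> y); rewrite big_ord1 mulr1.
have sxA : ksub (idfun \o cst) (scaled x A) by apply: ksub_scaled.
have [s As reps] := kspan_finite_reps sA (kdep_kspan sA sxA dep).
by exists {ffun 'I_d -> k}, s.
Qed.

Lemma fractional_ideal_invertible J : nonzero_fractional_ideal A J ->
  exists l : seq (F * F), (forall p, p \in l -> J p.1 /\ ideal_inv A J p.2) /\
    \sum_(p <- l) p.1 * p.2 = 1.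
Proof.
move=> [JD JM [x x0 Jx] [d [Ad d0 dJ]]].
pose I : set F := scaled d J.
have iI : is_ideal A I.
  split.
  - by exists 0; rewrite ?mulr0// -(mul0r x); apply: JM => //; apply: regular0.
  - by move=> _ _ [u Ju ->] [v Jv ->]; exists (u + v); [exact: JD|rewrite mulrDr].
  - by move=> a _ Aa [u Ju ->]; exists (a * u); [exact: JM|rewrite mulrCA].
  - by move=> _ [u Ju ->]; apply: dJ.
have [||l [lI lE]] := ideal_invertible regular1 regularB regularM
  regular_completely_closed regular_finite_quotient iI (x := d * x).
- by exists x.
- by rewrite mulf_neq0.
exists [seq (p.1 / d, d * p.2) | p <- l]; split.
  move=> _ /mapP[p pl ->] /=; have [[u Ju ->] pI] := lI p pl; split.
    by rewrite mulrAC divff// mul1r.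
  by move=> y Jy; rewrite mulrAC mulrC; apply: pI; exists y.
rewrite big_map -lE; apply: eq_bigr => p _ /=.
by rewrite mulrA mulfVK.
Qed.

End RegularFunctions.

(** * Ultrametric estimates *)

Section Ultrametric.
Variables (R : realType) (C : fieldType) (a : absval R C).
Implicit Types (x y z : C) (t e : R).

Lemma absv1 : a 1 = 1.
Proof.
apply: (mulfI (_ : a 1 != 0)); last by rewrite -absvM !mulr1.
by apply/eqP => /(@absv_eq0 _ _ a)/eqP; rewrite oner_eq0.
Qed.

Lemma absv_gt0 x : x != 0 -> 0 < a x.
Proof.
move=> x0; rewrite lt_neqAle absv_ge0 andbT eq_sym.
by apply: contra_neq x0; apply: absv_eq0.
Qed.

Lemma absvV x : a x^-1 = (a x)^-1.
Proof.
have [->|x0] := eqVneq x 0; first by rewrite invr0 absv0 invr0.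
apply: (mulfI (lt0r_neq0 (absv_gt0 x0))).
by rewrite -absvM !divff ?absv1// lt0r_neq0// absv_gt0.
Qed.

Lemma absvX x n : a (x ^+ n) = a x ^+ n.
Proof. by elim: n => [|n IH]; rewrite ?absv1// !exprS absvM IH. Qed.

Lemma absvD_le x y t : a x <= t -> a y <= t -> a (x + y) <= t.
Proof. by move=> xt yt; apply: le_trans (absvD a x y) _; rewrite ge_max xt. Qed.

Lemma absvB_le x y t : a x <= t -> a y <= t -> a (x - y) <= t.
Proof. by move=> xt yt; apply: absvD_le; rewrite ?absvN. Qed.

Lemma absv_sum_le (I : Type) (r : seq I) (P : pred I) (f : I -> C) t : 0 <= t ->
  (forall i, P i -> a (f i) <= t) -> a (\sum_(i <- r | P i) f i) <= t.
Proof.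
move=> t0 ft; apply: (big_ind (fun x => a x <= t)) => //; first by rewrite absv0.
by move=> x y; apply: absvD_le.
Qed.

Lemma absvD_eq x y : a y < a x -> a (x + y) = a x.
Proof.
move=> yx; apply/eqP; rewrite eq_le absvD_le//; last exact: ltW.
have [//|h] := leP (a x) (a (x + y)).
have : a (x + y - y) <= Num.max (a (x + y)) (a y).
  by rewrite -[in X in _ <= X](absvN a y); apply: absvD.
by rewrite addrK leNgt gt_max h yx.
Qed.

Lemma absv_distC x y : a (x - y) = a (y - x).
Proof. by rewrite -absvN opprB. Qed.

Lemma absv_prod (I : Type) (r : seq I) (P : pred I) (f : I -> C) :
  a (\prod_(i <- r | P i) f i) = \prod_(i <- r | P i) a (f i).
Proof. exact: (big_morph a (absvM a) absv1). Qed.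

Lemma prod_near1 (I : eqType) (r : seq I) (f : I -> C) t : 0 <= t <= 1 ->
  (forall i, i \in r -> a (f i - 1) <= t) -> a (\prod_(i <- r) f i - 1) <= t.
Proof.
move=> /andP[t0 t1]; elim: r => [|i r IH] fr.
  by rewrite big_nil subrr absv0.
rewrite big_cons; set p := \prod_(_ <- _) _.
have -> : f i * p - 1 = f i * (p - 1) + (f i - 1) by rewrite mulrBr mulr1 addrA subrK.
have fi := fr i (mem_head i r).
apply: absvD_le => //; rewrite absvM -[t]mul1r ler_pM ?absv_ge0//.
  rewrite -[f i](subrK 1); apply: absvD_le; last by rewrite absv1.
  exact: le_trans fi t1.
by apply: IH => j jr; apply: fr; rewrite inE jr orbT.
Qed.

Lemma prod_close (I : eqType) (r : seq I) (f g : I -> C) (M e : R) :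
  1 <= M -> 0 <= e -> (forall i, i \in r -> a (f i) <= M) ->
  (forall i, i \in r -> a (g i) <= M) -> (forall i, i \in r -> a (f i - g i) <= e) ->
  a (\prod_(i <- r) f i - \prod_(i <- r) g i) <= e * M ^+ size r.
Proof.
move=> M1 e0; have M0 : 0 <= M by apply: le_trans M1.
elim: r => [|i r IH] fM gM fg.
  by rewrite !big_nil subrr absv0 expr0 mulr1.
have tl (P : I -> Prop) : (forall j, j \in i :: r -> P j) -> forall j, j \in r -> P j.
  by move=> h j jr; apply: h; rewrite inE jr orbT.
rewrite !big_cons; set p := \prod_(_ <- _) _; set q := \prod_(_ <- _) _.
have -> : f i * p - g i * q = f i * (p - q) + (f i - g i) * q by ring.
apply: absvD_le; rewrite absvM.
  rewrite /= exprS mulrCA ler_pM ?absv_ge0 ?fM ?mem_head//.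
  by apply: IH; apply: tl.
rewrite ler_pM ?absv_ge0 ?fg ?mem_head// (@le_trans _ _ (M ^+ size r))//.
  rewrite /q absv_prod; elim: (r) (tl _ gM) => [|j s IHs] gs.
    by rewrite big_nil.
  rewrite big_cons /= exprS ler_pM ?absv_ge0 ?prodr_ge0 ?gs ?mem_head//.
    by move=> l _; apply: absv_ge0.
  by apply: IHs => l ls; apply: gs; rewrite inE ls orbT.
by rewrite ler_weXn2l /=.
Qed.

End Ultrametric.

(** * Additive polynomials *)

Section AdditivePolynomial.
Variable C : fieldType.
Implicit Types (V : {fset C}) (x y z : C).

Definition root_prod V z := \prod_(v <- V) (z - v).

Definition subgroup V := (0 \in V) /\ forall u v, u \in V -> v \in V -> u - v \in V.

Lemma size_monicB (p q : {poly C}) : p \is monic -> q \is monic ->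
  size p = size q -> (size (p - q)%R < size p)%N.
Proof.
move=> mp mq spq; rewrite -(prednK (_ : 0 < size p)%N) ?size_poly_gt0 ?monic_neq0// ltnS.
apply/leq_sizeP => i; rewrite coefB leq_eqVlt => /predU1P[<-|ip].
  by have /monicP := mp; have /monicP := mq; rewrite !lead_coefE spq => -> ->; rewrite subrr.
by rewrite !nth_default ?subrr// -?spq -(prednK (_ : 0 < size p)%N) ?size_poly_gt0 ?monic_neq0.
Qed.

Lemma root_prod_shift V v z : subgroup V -> v \in V -> root_prod V (v + z) = root_prod V z.
Proof.
move=> [V0 VB] vV; rewrite /root_prod.
rewrite [RHS](perm_big [seq u - v | u <- V]) /=.
  by rewrite big_map; apply: eq_bigr => u _; rewrite opprB addrA [z + v]addrC.
apply: uniq_perm; rewrite ?fset_uniq ?map_inj_uniq ?fset_uniq//; first exact: addIr.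
move=> u; apply/idP/mapP => [uV|[w wV ->]]; last exact: VB.
exists (u + v); rewrite ?addrK// -[v]opprK; apply: (VB) => //.
by rewrite -sub0r; apply: VB.
Qed.

(** For fixed y, the polynomial E(X + y) - E(X) - E(y) has degree less than the
    order of V, because the leading terms cancel, and it vanishes on V. *)
Lemma root_prod_additive V x y : subgroup V ->
  root_prod V (x + y) = root_prod V x + root_prod V y.
Proof.
move=> sV; pose p : {poly C} := \prod_(v <- V) ('X - v%:P).
have pE z : p.[z] = root_prod V z.
  by rewrite horner_prod; apply: eq_bigr => v _; rewrite hornerXsubC.
pose p' : {poly C} := p \Po ('X + y%:P).
have p'E : p' = \prod_(v <- [seq v - y | v <- V]) ('X - v%:P).
  rewrite /p' rmorph_prod big_map; apply: eq_bigr => v _ /=.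
  by rewrite comp_polyB comp_polyX comp_polyC rmorphB /= opprB addrA [RHS]addrAC addrAC.
have q0 : p' - p - (root_prod V y)%:P = 0.
  apply: (@roots_geq_poly_eq0 _ _ V).
  - apply/allP => v vV; rewrite rootE !hornerE /p' horner_comp !hornerE !pE.
    rewrite root_prod_shift// [root_prod V v](_ : _ = 0) ?subr0 ?subrr//.
    by apply/eqP; rewrite prodf_seq_eq0; apply/hasP; exists v => //=; rewrite subrr.
  - exact: fset_uniq.
  - rewrite (leq_trans (size_polyD _ _))// geq_max size_polyN; apply/andP; split.
      have := @size_monicB p' p; rewrite p'E !size_prod_XsubC size_map ltnS; apply=> //.
        exact: monic_prod_XsubC.
      exact: monic_prod_XsubC.
    rewrite (leq_trans (size_polyC_leq1 _))//.
    have : 0 \in enum_fset V by case: sV.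
    by case: (enum_fset V).
have := congr1 (fun q : {poly C} => q.[x]) q0.
rewrite /= !hornerE /p' horner_comp !hornerE !pE => /eqP.
by rewrite subr_eq0 subr_eq [_ + root_prod V x]addrC => /eqP.
Qed.

End AdditivePolynomial.

(** * Partial products of the lattice exponential *)

Section LatticeExponential.
Variables (R : realType) (C : fieldType) (a : absval R C).
Implicit Types (L : set C) (x y z : C) (t e : R).

Definition discrete_group L := [/\ L 0, forall x y, L x -> L y -> L (x - y)
  & forall t, finite_set (L `&` [set z | a z <= t])].

Definition lball L t : {fset C} := fset_set (L `&` [set z | a z <= t]).

(** The lattice points of norm at most t form a finite group, so this partial
    product of the exponential is an additive polynomial. *)
Definition partial_exp L t z := z * \prod_(x <- (lball L t `\ 0)%fset) (1 - z / x).

Section Fixed.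
Variable L : set C.
Hypothesis dL : discrete_group L.

Lemma lballP t x : reflect (L x /\ a x <= t) (x \in lball L t).
Proof.
case: dL => _ _ fL; rewrite in_fset_set; last exact: fL.
by apply: (iffP idP) => [/set_mem|h]; last apply/mem_set.
Qed.

Lemma subgroup_lball t : 0 <= t -> subgroup (lball L t).
Proof.
case: dL => L0 LB _ t0; split; first by apply/lballP; rewrite absv0.
move=> u v /lballP[Lu ut] /lballP[Lv vt]; apply/lballP; split; first exact: LB.
exact: absvB_le.
Qed.

Lemma partial_expE t z : 0 <= t ->
  partial_exp L t z = root_prod (lball L t) z / \prod_(x <- (lball L t `\ 0)%fset) - x.
Proof.
move=> t0; have [V0 _] := subgroup_lball t0.
rewrite /root_prod (big_fsetD1 0)//= subr0 /partial_exp -mulrA; congr (_ * _).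
rewrite -prodf_div big_seq [RHS]big_seq; apply: eq_bigr => x; rewrite in_fsetD1 => /andP[x0 _].
by rewrite mulrBl invrN mulrN mulrN opprK divff// addrC.
Qed.

Lemma partial_expD t x y : 0 <= t ->
  partial_exp L t (x + y) = partial_exp L t x + partial_exp L t y.
Proof.
move=> t0; rewrite !partial_expE// root_prod_additive ?mulrDl//.
exact: subgroup_lball.
Qed.

Lemma partial_exp_eq0 t z : 0 <= t -> (partial_exp L t z == 0) = (z \in lball L t).
Proof.
move=> t0; have [V0 _] := subgroup_lball t0.
rewrite partial_expE// mulf_eq0 invr_eq0 [X in _ || X](_ : _ = false) ?orbF; last first.
  apply/negbTE; rewrite prodf_seq_neq0; apply/allP => x.
  by rewrite in_fsetD1 oppr_eq0 => /andP[].
rewrite prodf_seq_eq0; apply/hasP/idP => [[x xV]|zV]; last by exists z; rewrite //= subrr.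
by rewrite /= subr_eq0 => /eqP ->.
Qed.

Lemma partial_expB t x y : 0 <= t ->
  partial_exp L t (x - y) = partial_exp L t x - partial_exp L t y.
Proof. by move=> t0; apply/eqP; rewrite eq_sym subr_eq -partial_expD// subrK. Qed.

Lemma partial_prod_split t z (S : {fset C}) :
  [set` (lball L t `\ 0)%fset] `<=` [set` S] ->
  z * \prod_(x <- S) (1 - z / x) =
  partial_exp L t z * \prod_(x <- S | x \notin (lball L t `\ 0)%fset) (1 - z / x).
Proof.
move=> VS; rewrite /partial_exp -mulrA; congr (_ * _).
rewrite (bigID (mem (lball L t `\ 0)%fset)) /=; congr (_ * _).
rewrite -big_filter; apply: perm_big; apply: uniq_perm; rewrite ?filter_uniq ?fset_uniq//.
move=> x; rewrite mem_filter; apply/andP/idP => [[]//|xV]; split=> //.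
exact: VS.
Qed.

(** The factors outside the ball of radius t differ from 1 by at most |z| / t. *)
Lemma partial_prod_close t z (S : {fset C}) : 0 < t -> a z <= t ->
  [set` (lball L t `\ 0)%fset] `<=` [set` S] -> [set` S] `<=` L `\ 0 ->
  a (z * \prod_(x <- S) (1 - z / x) - partial_exp L t z)
    <= a (partial_exp L t z) * (a z / t).
Proof.
move=> t0 zt VS SL; rewrite (partial_prod_split _ VS).
rewrite -{2}[partial_exp _ _ _]mulr1 -mulrBr absvM ler_wpM2l ?absv_ge0//.
rewrite -big_filter; apply: prod_near1.
  by rewrite ler_pdivrMr// mul1r zt divr_ge0 ?absv_ge0// ltW.
move=> x; rewrite mem_filter => /andP[xV xS].
have [Lx x0] := SL x xS.
rewrite addrAC subrr add0r absvN absvM absvV ler_wpM2l ?absv_ge0// lef_pV2 ?posrE//.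
- rewrite leNgt; apply: contra xV => xt; rewrite in_fsetD1; apply/andP; split.
    by apply/eqP.
  by apply/lballP; split=> //; apply: ltW.
- by apply: absv_gt0; apply/eqP.
Qed.

Lemma partial_prod_abs t z (S : {fset C}) : a z <= t ->
  [set` (lball L t `\ 0)%fset] `<=` [set` S] -> [set` S] `<=` L `\ 0 ->
  a (z * \prod_(x <- S) (1 - z / x)) = a (partial_exp L t z).
Proof.
move=> zt VS SL; rewrite (partial_prod_split _ VS) absvM.
rewrite [X in _ * X](_ : _ = 1) ?mulr1// absv_prod -big_filter big_seq big1// => x.
rewrite mem_filter => /andP[xV xS]; have [Lx /eqP x0] := SL x xS.
rewrite absvD_eq absv1// absvN absvM absvV ltr_pdivrMr ?absv_gt0// mul1r.
apply: le_lt_trans zt _; rewrite ltNge; apply: contra xV => xt.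
by rewrite in_fsetD1 x0; apply/lballP.
Qed.

Lemma lball_subset t t' : t <= t' ->
  [set` (lball L t `\ 0)%fset] `<=` [set` (lball L t' `\ 0)%fset].
Proof.
move=> tt x /=; rewrite !in_fsetD1 => /andP[-> /lballP[Lx xt]].
by apply/lballP; split=> //; apply: le_trans tt.
Qed.

Lemma lballD1_subset t : [set` (lball L t `\ 0)%fset] `<=` L `\ 0.
Proof. by move=> x /=; rewrite in_fsetD1 => /andP[/eqP x0 /lballP[Lx _]]. Qed.

Lemma partial_exp_abs t t' z : a z <= t -> t <= t' ->
  a (partial_exp L t' z) = a (partial_exp L t z).
Proof.
move=> zt tt; apply: partial_prod_abs => //; first exact: lball_subset.
exact: lballD1_subset.
Qed.

Lemma partial_exp_close t t' z : 0 < t -> a z <= t -> t <= t' ->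
  a (partial_exp L t' z - partial_exp L t z) <= a (partial_exp L t z) * (a z / t).
Proof.
move=> t0 zt tt; apply: partial_prod_close => //; first exact: lball_subset.
exact: lballD1_subset.
Qed.

Hypothesis complete_a : av_complete a.

Lemma lattice_exp_exists z : exists l, is_lattice_exp a L z l.
Proof.
pose t0 := a z + 1.
have t00 : 0 < t0 by rewrite ltr_wpDl ?absv_ge0.
pose t n : R := t0 + n%:R.
have tn0 n : 0 < t n by rewrite /t ltr_wpDr.
have zt n : a z <= t n by rewrite /t /t0 -addrA lerDl addr_ge0.
have t_mono m n : (m <= n)%N -> t m <= t n by move=> mn; rewrite /t lerD2l ler_nat.
pose c := a (partial_exp L t0 z) * a z.
have c0 : 0 <= c by rewrite mulr_ge0 ?absv_ge0.
have bound n : a (partial_exp L (t n) z) * (a z / t n) = c / t n.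
  rewrite mulrA (@partial_exp_abs t0)//; last by rewrite /t lerDl.
  by have := zt 0%N; rewrite /t addr0.
have small e : 0 < e -> exists N, forall n, (N <= n)%N -> c / t n < e.
  move=> e0; have [N cN] : exists N, c / e < N%:R.
    by exists (Num.bound (c / e)); apply: archi_boundP; rewrite divr_ge0// ltW.
  exists N => n Nn; rewrite ltr_pdivrMr// mulrC -ltr_pdivrMr//.
  apply: lt_le_trans cN _; rewrite /t (@le_trans _ _ (n%:R))// ?ler_nat//.
  by rewrite lerDr ltW.
have [|l Hl] := @complete_a (fun n : nat => partial_exp L (t n) z).
  move=> e e0; have [N HN] := small e e0; exists N => m n.
  wlog mn : m n / (m <= n)%N.
    move=> W Nm Nn; have [/W|/ltnW/W] := leqP m n; first exact.
    by rewrite absv_distC; apply.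
  move=> Nm Nn; rewrite absv_distC; apply: le_lt_trans (HN m Nm).
  by rewrite -bound; apply: partial_exp_close => //; apply: t_mono.
exists l => e e0; have [N HN] := small e e0.
have /cvgrPdist_lt /(_ e e0) [M _ HM] := Hl.
pose n := maxn N M.
exists (lball L (t n) `\ 0)%fset; first exact: lballD1_subset.
move=> S VS SL; rewrite -(subrKA (partial_exp L (t n) z)).
apply: le_lt_trans (absvD _ _ _) _; rewrite gt_max; apply/andP; split.
  apply: le_lt_trans (partial_prod_close _ _ VS SL) _ => //.
  by rewrite bound; apply: HN; apply: leq_maxl.
by have := HM n (leq_maxr _ _); rewrite /= sub0r normrN ger0_norm ?absv_ge0.
Qed.

Lemma lattice_exp_close t z : 0 < t -> a z <= t ->
  a (lattice_exp a L z - partial_exp L t z) <= a (partial_exp L t z) * (a z / t).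
Proof.
move=> t0 zt; have Hl : is_lattice_exp a L z (lattice_exp a L z).
  exact: xgetPex (lattice_exp_exists z).
apply/ler_addgt0Pr => e e0; have [S0 S0L HS] := Hl e e0.
pose S := (S0 `|` (lball L t `\ 0))%fset.
have VS : [set` (lball L t `\ 0)%fset] `<=` [set` S].
  by move=> x /= xV; rewrite in_fsetU xV orbT.
have SL : [set` S] `<=` L `\ 0.
  by move=> x /=; rewrite in_fsetU => /orP[/S0L//|]; apply: lballD1_subset.
have SS : [set` S0] `<=` [set` S] by move=> x /= xS; rewrite in_fsetU xS.
rewrite -(subrKA (z * \prod_(x <- S) (1 - z / x))).
apply: le_trans (absvD _ _ _) _; rewrite ge_max; apply/andP; split.
  rewrite absv_distC (le_trans (ltW (HS S SS SL)))// lerDr mulr_ge0 ?absv_ge0//.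
  by rewrite divr_ge0 ?absv_ge0// ltW.
by apply: le_trans (partial_prod_close t0 zt VS SL) _; rewrite lerDl ltW.
Qed.

End Fixed.

End LatticeExponential.

(** * Properties of the lattice exponential *)

Lemma seq_argmin (R : realType) (T : eqType) (s : seq T) (f : T -> R) x : x \in s ->
  exists2 y, y \in s & forall z, z \in s -> f y <= f z.
Proof.
elim: s x => // u s IH x _; case: s IH => [_|v s IH].
  by exists u; rewrite ?mem_head// => z; rewrite inE => /eqP ->.
have [y ys ymin] := IH v (mem_head v s).
have [uy|yu] := leP (f u) (f y).
  exists u; rewrite ?mem_head// => z; rewrite inE => /predU1P[->//|/ymin].
  exact: le_trans.
exists y; first by rewrite inE ys orbT.
by move=> z; rewrite inE => /predU1P[->|/ymin//]; apply: ltW.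
Qed.

Section LatticeExponentialTheory.
Variables (R : realType) (C : fieldType) (a : absval R C) (L : set C).
Hypotheses (dL : discrete_group a L) (complete_a : av_complete a).
Implicit Types (x y z : C) (t e : R).
Let P := partial_exp a L.
Let expL := lattice_exp a L.

Lemma partial_exp_bounded rho : 0 < rho -> exists2 M, 0 <= M &
  forall z t, a z <= rho -> rho <= t -> a (P t z) <= M.
Proof.
move=> r0; pose f x := Num.max 1 (rho / a x).
have f0 x : 0 <= f x by rewrite le_max ler01.
exists (rho * \prod_(x <- (lball a L rho `\ 0)%fset) f x).
  by rewrite mulr_ge0 ?(ltW r0)// prodr_ge0.
move=> z t zr rt; rewrite (partial_exp_abs dL zr rt) absvM.
rewrite ler_pM ?absv_ge0// absv_prod ler_prod// => x _.
rewrite absv_ge0 /=; apply: absvB_le; rewrite /f le_max ?absv1 ?lexx//.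
by rewrite absvM absvV ler_wpM2r ?orbT// invr_ge0 absv_ge0.
Qed.

Lemma lattice_exp_bounded rho : 0 < rho -> exists2 M, 0 <= M &
  forall z, a z <= rho -> a (expL z) <= M.
Proof.
move=> r0; have [M M0 HM] := partial_exp_bounded r0; exists M => // z zr.
rewrite -[expL z](subrK (P rho z)); apply: absvD_le; last exact: HM.
apply: le_trans (lattice_exp_close dL complete_a r0 zr) _.
apply: le_trans (HM z rho zr (lexx _)); rewrite -[leRHS]mulr1 ler_wpM2l ?absv_ge0//.
by rewrite ler_pdivrMr// mul1r.
Qed.

Lemma partial_exp_cvg z e : 0 < e -> exists2 t0, 0 < t0 &
  forall t, t0 <= t -> a (P t z - expL z) < e.
Proof.
move=> e0; pose r := a z + 1; have r0 : 0 < r by rewrite ltr_wpDl ?absv_ge0.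
have zr : a z <= r by rewrite lerDl.
pose c := a (P r z) * a z; have c0 : 0 <= c by rewrite mulr_ge0 ?absv_ge0.
exists (Num.max r (c / e + 1)); first by rewrite lt_max r0.
move=> t; rewrite ge_max => /andP[rt ct]; have t0 := lt_le_trans r0 rt.
rewrite absv_distC; apply: le_lt_trans (lattice_exp_close dL complete_a t0 (le_trans zr rt)) _.
rewrite (partial_exp_abs dL zr rt) mulrA ltr_pdivrMr// [e * t]mulrC -ltr_pdivrMr//.
by apply: (lt_le_trans _ ct); rewrite ltrDl.
Qed.

Lemma lattice_expB x y : expL (x - y) = expL x - expL y.
Proof.
apply/eqP; rewrite -subr_eq0; apply/eqP/(@absv_eq0 _ _ a)/eqP.
rewrite eq_le absv_ge0 andbT; apply/ler_addgt0Pr => e e0; rewrite add0r.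
have [t1 t10 H1] := partial_exp_cvg (x - y) e0.
have [t2 t20 H2] := partial_exp_cvg x e0.
have [t3 t30 H3] := partial_exp_cvg y e0.
pose t := Num.max t1 (Num.max t2 t3).
have [l1 l2 l3] : [/\ t1 <= t, t2 <= t & t3 <= t] by rewrite /t !le_max !lexx !orbT.
rewrite (_ : _ - _ = (P t x - expL x) - (P t y - expL y) - (P t (x - y) - expL (x - y))).
  by apply: absvB_le; [apply: absvB_le|]; apply: ltW; [apply: H2|apply: H3|apply: H1].
have -> : P t (x - y) = P t x - P t y.
  by apply: partial_expB => //; apply: ltW; exact: lt_le_trans t10 l1.
by ring.
Qed.

(** Let l be a point of L nearest to z and y = z - l. Then e(z) = e(y), and each
    factor 1 - y / x of e(y) has absolute value at least 1 because y is not
    closer to x than to 0. *)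
Lemma nearest_lattice_point z : exists2 l, L l & a (z - l) <= a (expL z).
Proof.
have [L0 LB _] := dL.
have LD u v : L u -> L v -> L (u + v).
  by move=> Lu Lv; rewrite -[v]opprK; apply: (LB) => //; rewrite -sub0r; apply: LB.
have z0 : 0 \in lball a L (a z) by apply/(lballP dL); rewrite absv0 absv_ge0.
have [l lz lmin] := seq_argmin (fun l => a (z - l)) z0.
have [Ll lez] := lballP dL _ _ lz.
exists l => //; set y := z - l.
have ymin x : L x -> a y <= a (y - x).
  move=> Lx; rewrite -addrA -opprD.
  have [h|h] := leP (a (l + x)) (a z).
    by apply: lmin; apply/(lballP dL); split=> //; apply: LD.
  apply: le_trans (lmin 0 z0) _; rewrite subr0 addrC absvD_eq ?absvN// ltW//.
have Py t : 0 < t -> a z <= t -> a y <= a (P t z).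
  move=> t0 zt; have -> : P t z = P t y.
    rewrite [RHS](partial_expB dL) ?(ltW t0)// [X in _ = _ - X](_ : _ = 0) ?subr0//.
    apply/eqP; rewrite (partial_exp_eq0 dL) ?(ltW t0)//; apply/(lballP dL); split=> //.
    exact: le_trans lez zt.
  rewrite absvM -[leLHS]mulr1 ler_wpM2l ?absv_ge0// absv_prod big_seq.
  apply: (big_ind (fun r : R => 1 <= r)) => // [u v u1 v1|x].
    by rewrite -[1]mulr1 ler_pM.
  rewrite in_fsetD1 => /andP[x0 /(lballP dL)[Lx _]].
  have -> : 1 - y / x = (x - y) / x by rewrite [RHS]mulrBl divff.
  rewrite absvM absvV ler_pdivlMr ?absv_gt0// mul1r absv_distC.
  by rewrite -{1}[x](subKr y); apply: absvB_le => //; apply: ymin.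
apply/ler_addgt0Pr => e e0; have [t1 t10 H1] := partial_exp_cvg z e0.
pose t := Num.max t1 (a z).
have t1t : t1 <= t by rewrite le_max lexx.
have t0 := lt_le_trans t10 t1t.
apply: le_trans (Py t t0 _) _; first by rewrite le_max lexx orbT.
rewrite -[P t z](subrK (expL z)); apply: le_trans (absvD _ _ _) _.
by rewrite ge_max [X in _ && X]lerDl (ltW e0) andbT (le_trans (ltW (H1 t t1t)))// lerDr absv_ge0.
Qed.

Lemma lattice_exp_lattice l : L l -> expL l = 0.
Proof.
move=> Ll; apply/(@absv_eq0 _ _ a)/eqP.
rewrite eq_le absv_ge0 andbT; apply/ler_addgt0Pr => e e0; rewrite add0r.
have [t1 t10 H1] := partial_exp_cvg l e0; pose t := Num.max t1 (a l).
have t1t : t1 <= t by rewrite le_max lexx.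
have := H1 t t1t; rewrite (_ : P t l = 0) ?sub0r ?absvN; first exact: ltW.
apply/eqP; rewrite (partial_exp_eq0 dL); last exact: ltW (lt_le_trans t10 t1t).
by apply/(lballP dL); split=> //; rewrite le_max lexx orbT.
Qed.

Variables (alpha : C) (N : nat).
Hypotheses (alpha_gt1 : 1 < a alpha) (Lalpha : forall x, L x -> L (alpha * x))
  (index_le : forall y : 'I_N.+1 -> C, (forall i, L (alpha * y i)) ->
     exists i j, i != j /\ L (y i - y j)).

Lemma alpha_neq0 : alpha != 0.
Proof. by apply: contraTneq alpha_gt1 => ->; rewrite absv0 ltr10. Qed.

(** With V the points of L in the ball of radius t and W those in the ball of
    radius |alpha| t, the group alpha^-1 W contains V with index at most N.
    Grouping the factors of the product over alpha^-1 W by cosets of V and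
    using additivity, one obtains a product of the E(z) - E(x) over coset
    representatives x, where E is the product over V. *)
Lemma partial_exp_poly t : 0 <= t -> exists2 p : {poly C}, (size p <= N.+1)%N &
  forall z, P (a alpha * t) (alpha * z) = p.[P t z].
Proof.
move=> t0; have a0 := alpha_neq0; have aa0 := absv_gt0 a a0.
have at0 : 0 <= a alpha * t by rewrite mulr_ge0 ?absv_ge0.
pose V := lball a L t; pose W := lball a L (a alpha * t).
have sV : subgroup V by apply: subgroup_lball.
have sW : subgroup W by apply: subgroup_lball.
have [V0 VB] := sV; have [W0 WB] := sW.
have VD u v : u \in V -> v \in V -> u + v \in V.
  by move=> uV vV; rewrite -[v]opprK; apply: (VB) => //; rewrite -sub0r; apply: VB.
pose s := [seq alpha^-1 * x | x <- W].
have us : uniq s by rewrite map_inj_uniq ?fset_uniq//; apply: mulfI; rewrite invr_eq0.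
have sP x : (x \in s) = (alpha * x \in W).
  apply/mapP/idP => [[w wW ->]|xW]; first by rewrite mulVKf.
  by exists (alpha * x) => //; rewrite mulKf.
have Vs x : x \in V -> x \in s.
  move=> /(lballP dL)[Lx xt]; rewrite sP; apply/(lballP dL); split; first exact: Lalpha.
  by rewrite absvM ler_wpM2l ?absv_ge0.
have sB u v : u \in s -> v \in s -> u - v \in s.
  by rewrite !sP mulrBr; apply: WB.
have sLV u : u \in s -> L u -> u \in V.
  rewrite sP => /(lballP dL)[_]; rewrite absvM ler_pM2l// => ut Lu.
  by apply/(lballP dL).
pose rep v := choose (fun u => v - u \in V) v.
have repP v : v - rep v \in V.
  by apply: (@chooseP _ (fun u => v - u \in V)); rewrite subrr.
have rep_eq u v : u - v \in V -> rep u = rep v.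
  move=> uv; have uv' : v - u \in V by rewrite -opprB -sub0r; apply: VB.
  rewrite /rep (@eq_choose _ _ (fun w => v - w \in V)); last first.
    move=> w; apply/idP/idP => h; first by rewrite -(subrKA u); apply: VD.
    by rewrite -(subrKA v); apply: VD.
  by apply: choose_id; rewrite ?subrr.
(* T is a set of representatives of alpha^-1 W modulo V. *)
pose T := undup [seq rep v | v <- s].
have Trep x : x \in T -> exists2 v, v \in s & x = rep v by rewrite mem_undup => /mapP.
have Tid x : x \in T -> rep x = x.
  by move=> /Trep[v _ ->]; apply/esym/rep_eq/repP.
have Ts x : x \in T -> x \in s.
  move=> /Trep[v vs ->]; rewrite -(subKr v (rep v)); apply: sB => //.
  exact/Vs/repP.
have sizeT : (size T <= N)%N.
  rewrite leqNgt; apply/negP => NT.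
  have [l|i [j [ij Lij]]] := index_le (y := fun i => T`_i).
    have : T`_l \in s by apply/Ts/mem_nth; apply: leq_trans NT; apply: ltn_ord.
    by rewrite sP => /(lballP dL)[].
  have iT (m : 'I_N.+1) : T`_m \in T by apply/mem_nth; apply: leq_trans NT; apply: ltn_ord.
  have : rep T`_i = rep T`_j by apply/rep_eq/sLV => //; apply: sB; apply: Ts; apply: iT.
  rewrite !Tid ?iT// => /eqP; rewrite nth_uniq ?undup_uniq//; last 2 first.
  - by apply: leq_trans NT; apply: ltn_ord.
  - by apply: leq_trans NT; apply: ltn_ord.
  by move=> /eqP/val_inj/eqP; apply/negP.
have prodW z : root_prod W (alpha * z) = alpha ^+ size s *
    \prod_(x <- T) (root_prod V z - root_prod V x).
  transitivity (\prod_(x <- s) (alpha * (z - x))).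
    rewrite big_map; apply: eq_bigr => x _.
    by rewrite mulrBr mulVKf.
  rewrite big_split /= big_const_seq count_predT iter_mulr_1; congr (_ * _).
  rewrite (perm_big [seq x + v | x <- T, v <- V]) /=.
    rewrite big_allpairs_dep; apply: eq_bigr => x _.
    transitivity (root_prod V (z - x)).
      by apply: eq_bigr => v _; rewrite opprD addrA.
    by apply/eqP; rewrite eq_sym subr_eq -root_prod_additive// subrK.
  apply: uniq_perm => //.
    apply: allpairs_uniq; rewrite ?undup_uniq ?fset_uniq// => p p'.
    move=> /allpairsP[[x v] [/= xT vV ->]] /allpairsP[[x' v'] [/= xT' vV' ->]] /= e.
    have xx' : x = x'.
      rewrite -(Tid x)// -(Tid x')//; apply: rep_eq.
      rewrite (_ : x - x' = v' - v); first exact: VB.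
      by apply/eqP; rewrite subr_eq addrAC eq_sym subr_eq addrC -e addrC.
    by move: e; rewrite xx' => /addrI ->.
  move=> x; apply/idP/allpairsP => [xs|[[u v] [/= uT vV ->]]].
    exists (rep x, x - rep x) => /=; split; last by rewrite addrC subrK.
      by rewrite mem_undup; apply: map_f.
    exact: repP.
  rewrite -[v]opprK; apply: sB; first exact: Ts.
  by apply: Vs; rewrite -sub0r; apply: VB.
pose k1 := \prod_(x <- (V `\ 0)%fset) - x; pose k2 := \prod_(x <- (W `\ 0)%fset) - x.
have k10 : k1 != 0.
  rewrite prodf_seq_neq0; apply/allP => x.
  by rewrite in_fsetD1 oppr_eq0 => /andP[].
pose p := \prod_(x <- T) ('X - (root_prod V x)%:P).
exists ((alpha ^+ size s / k2) *: (p \Po (k1 *: 'X))).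
  apply: leq_trans (size_scale_leq _ _) _.
  rewrite size_comp_poly2 ?size_scale ?size_polyX// /p.
  by rewrite -(big_map (root_prod V) xpredT (fun y => 'X - y%:P)) size_prod_XsubC size_map ltnS.
move=> z; rewrite /P !partial_expE// prodW hornerZ horner_comp.
rewrite (_ : (k1 *: 'X).[_] = root_prod V z); last by rewrite hornerZ hornerX mulrC mulfVK.
rewrite horner_prod mulrAC; congr (_ * _).
by apply: eq_bigr => x _; rewrite hornerXsubC.
Qed.

End LatticeExponentialTheory.

(** * Lagrange interpolation and uniform convergence *)

Section Lagrange.
Variable C : fieldType.

Definition lagrange_value n (w v : 'I_n -> C) (y : C) : C :=
  \sum_j v j * \prod_(i | i != j) ((y - w i) / (w j - w i)).

Lemma lagrange_interpolation n (w : 'I_n -> C) (p : {poly C}) y :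
  injective w -> (size p <= n)%N -> p.[y] = lagrange_value w (fun j => p.[w j]) y.
Proof.
move=> winj sp.
pose l j : {poly C} := (\prod_(i | i != j) (w j - w i)^-1) *: \prod_(i | i != j) ('X - (w i)%:P).
have lE j z : (l j).[z] = \prod_(i | i != j) ((z - w i) / (w j - w i)).
  rewrite hornerZ horner_prod -big_split; apply: eq_bigr => i _ /=.
  by rewrite hornerXsubC mulrC.
pose q := p - \sum_j p.[w j] *: l j.
have qE z : q.[z] = p.[z] - lagrange_value w (fun j => p.[w j]) z.
  rewrite /q hornerD hornerN horner_sum; congr (_ - _).
  by apply: eq_bigr => j _; rewrite hornerZ lE.
suff q0 : q = 0 by apply/subr0_eq; rewrite -qE q0 horner0.
apply: (@roots_geq_poly_eq0 _ _ [seq w j | j <- enum 'I_n]).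
- apply/allP => _ /mapP[j _ ->]; rewrite rootE qE subr_eq0 /lagrange_value.
  rewrite (bigD1 j) //= [X in _ * X]big1 ?mulr1; last first.
    by move=> i ij; rewrite divff// subr_eq0 (inj_eq winj) eq_sym.
  rewrite big1 ?addr0// => m mj.
  by rewrite (bigD1 j) 1?eq_sym//= subrr mul0r mul0r mulr0.
- by rewrite map_inj_uniq ?enum_uniq.
- rewrite size_map size_enum_ord (leq_trans (size_polyD _ _))// geq_max sp size_polyN.
  apply: (big_ind (fun q : {poly C} => (size q <= n)%N)); rewrite ?size_poly0//.
    by move=> u v un vn; rewrite (leq_trans (size_polyD _ _))// geq_max un.
  move=> j _; rewrite (leq_trans (size_scale_leq _ _))// (leq_trans (size_scale_leq _ _))//.
  rewrite -big_filter -(big_map w xpredT (fun x => 'X - x%:P)) size_prod_XsubC size_map.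
  rewrite -sum1_size big_filter sum1_card.
  have := cardC1 j; rewrite card_ord => cE.
  by rewrite (eq_card (B := predC1 j))// cE prednK// (leq_trans _ (ltn_ord j)).
Qed.

End Lagrange.

Section UniformConvergence.
Variables (R : realType) (C : fieldType) (a : absval R C).
Variables (T : Type) (G : set_system T) (X : Type) (D : set X).
Context {FG : Filter G}.
Implicit Types (f g : T -> X -> C) (u v : X -> C) (e : R).

Definition ucvg f u := forall e, 0 < e -> \forall t \near G, forall x, D x -> a (f t x - u x) <= e.

Definition ubounded u := exists2 M : R, 0 <= M & forall x, D x -> a (u x) <= M.

Lemma ucvgB f g u v : ucvg f u -> ucvg g v -> ucvg (fun t x => f t x - g t x) (fun x => u x - v x).
Proof.
move=> fu gv e e0; apply: filterS2 (fu e e0) (gv e e0) => t ft gt x Dx.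
rewrite (_ : _ - _ = (f t x - u x) - (g t x - v x)); last by ring.
by apply: absvB_le; [apply: ft|apply: gt].
Qed.

Lemma ucvgD f g u v : ucvg f u -> ucvg g v -> ucvg (fun t x => f t x + g t x) (fun x => u x + v x).
Proof.
move=> fu gv e e0; apply: filterS2 (fu e e0) (gv e e0) => t ft gt x Dx.
rewrite (_ : _ - _ = (f t x - u x) + (g t x - v x)); last by ring.
by apply: absvD_le; [apply: ft|apply: gt].
Qed.

Lemma uboundedM u v : ubounded u -> ubounded v -> ubounded (fun x => u x * v x).
Proof.
move=> [M M0 uM] [N N0 vN]; exists (M * N); first exact: mulr_ge0.
by move=> x Dx; rewrite absvM ler_pM ?absv_ge0 ?uM ?vN.
Qed.

Lemma uboundedB u v : ubounded u -> ubounded v -> ubounded (fun x => u x - v x).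
Proof.
move=> [M M0 uM] [N N0 vN]; exists (Num.max M N); first by rewrite le_max M0.
by move=> x Dx; apply: absvB_le; rewrite le_max ?uM ?vN ?orbT.
Qed.

Lemma ubounded_cst c : ubounded (fun _ => c).
Proof. by exists (a c); rewrite ?absv_ge0. Qed.

Lemma ucvgM f g u v : ubounded u -> ubounded v -> ucvg f u -> ucvg g v ->
  ucvg (fun t x => f t x * g t x) (fun x => u x * v x).
Proof.
move=> [M M0 uM] [N N0 vN] fu gv e e0.
pose d := Num.min 1 (e / (M + N + 1)).
have MN0 : 0 < M + N + 1 by rewrite ltr_wpDl// addr_ge0.
have d0 : 0 < d by rewrite lt_min ltr01 divr_gt0.
have [d1 de] : d <= 1 /\ d * (M + N + 1) <= e.
  by rewrite /d; split; rewrite ?ge_min ?lexx// -ler_pdivlMr// ge_min lexx orbT.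
apply: filterS2 (fu d d0) (gv d d0) => t ft gt x Dx.
have fx := ft x Dx; have gx := gt x Dx; have ux := uM x Dx; have vx := vN x Dx.
rewrite (_ : _ - _ = (f t x - u x) * (g t x - v x) + (f t x - u x) * v x + u x * (g t x - v x));
  last by ring.
apply: absvD_le; first apply: absvD_le; apply: le_trans de; rewrite absvM.
- apply: (@le_trans _ _ (d * 1)); first by rewrite ler_pM ?absv_ge0// (le_trans gx).
  by rewrite ler_wpM2l ?(ltW d0)// lerDr addr_ge0.
- apply: (@le_trans _ _ (d * N)); first by rewrite ler_pM ?absv_ge0.
  by rewrite ler_wpM2l ?(ltW d0)// -addrA addrCA lerDl addr_ge0.
- apply: (@le_trans _ _ (d * M)); first by rewrite mulrC ler_pM ?absv_ge0.
  by rewrite ler_wpM2l ?(ltW d0)// -addrA lerDl addr_ge0.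
Qed.

Lemma ucvgV (f : T -> C) c : c != 0 -> ucvg (fun t _ => f t) (fun _ => c) ->
  ucvg (fun t _ => (f t)^-1) (fun _ => c^-1).
Proof.
move=> c0 fc e e0; have ac0 := absv_gt0 a c0.
pose d := Num.min (a c / 2) (e * a c ^+ 2).
have d0 : 0 < d by rewrite lt_min divr_gt0// mulr_gt0// exprn_gt0.
apply: filterS (fc d d0) => t ft x Dx; have fx := ft x Dx.
have dc : d < a c by rewrite gt_min ltr_pdivrMr// mulr_natr mulr2n ltrDl ac0.
have fE : a (f t) = a c.
  by rewrite -[f t](subrK c) addrC absvD_eq// (le_lt_trans fx).
have f0 : f t != 0 by apply: contraTneq ac0 => f0; rewrite -fE f0 absv0 ltxx.
have -> : (f t)^-1 - c^-1 = (c - f t) / (f t * c) by field; rewrite c0.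
rewrite absvM absvV absvM fE ler_pdivrMr ?mulr_gt0// absv_distC.
by apply: le_trans fx _; rewrite -expr2 ge_min lexx orbT.
Qed.

Lemma ucvg_sum (I : Type) (r : seq I) (P : pred I) (f : I -> T -> X -> C) (u : I -> X -> C) :
  (forall i, P i -> ucvg (f i) (u i)) ->
  ucvg (fun t x => \sum_(i <- r | P i) f i t x) (fun x => \sum_(i <- r | P i) u i x).
Proof.
move=> fu; elim: r => [|i r IH].
  by move=> e e0; near=> t => x _; rewrite !big_nil subrr absv0 ltW.
have [Pi|nPi] := boolP (P i); last first.
  by move=> e /IH; apply: filterS => t ft x /ft; rewrite !big_cons (negPf nPi).
by move=> e /(ucvgD (fu i Pi) IH); apply: filterS => t ft x /ft; rewrite !big_cons Pi.
Unshelve. all: by end_near. Qed.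

Lemma ucvg_prod (I : Type) (r : seq I) (P : pred I) (f : I -> T -> X -> C) (u : I -> X -> C) :
  (forall i, P i -> ucvg (f i) (u i)) -> (forall i, P i -> ubounded (u i)) ->
  ucvg (fun t x => \prod_(i <- r | P i) f i t x) (fun x => \prod_(i <- r | P i) u i x) /\
  ubounded (fun x => \prod_(i <- r | P i) u i x).
Proof.
move=> fu bu; elim: r => [|i r [IH1 IH2]].
  split; last by exists 1 => // x _; rewrite big_nil absv1.
  by move=> e e0; near=> t => x _; rewrite !big_nil subrr absv0 ltW.
have [Pi|nPi] := boolP (P i); last first.
  split; first by move=> e /IH1; apply: filterS => t ft x /ft; rewrite !big_cons (negPf nPi).
  by case: IH2 => M M0 h; exists M => // x /h; rewrite big_cons (negPf nPi).
split.
  by move=> e /(ucvgM (bu i Pi) IH2 (fu i Pi) IH1); apply: filterS => t ft x /ft; rewrite !big_cons Pi.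
have [M M0 h] := uboundedM (bu i Pi) IH2.
by exists M => // x /h; rewrite big_cons Pi.
Unshelve. all: by end_near. Qed.

Lemma ucvg_lagrange n (w v : T -> 'I_n -> C) (w0 v0 : 'I_n -> C) (f : T -> X -> C) (u : X -> C) :
  injective w0 -> ubounded u -> ucvg f u ->
  (forall i, ucvg (fun t _ => w t i) (fun _ => w0 i)) ->
  (forall i, ucvg (fun t _ => v t i) (fun _ => v0 i)) ->
  ucvg (fun t x => lagrange_value (w t) (v t) (f t x))
       (fun x => lagrange_value w0 v0 (u x)).
Proof.
move=> winj bu fu ww vv.
pose F j t x := v t j * \prod_(i | i != j) ((f t x - w t i) / (w t j - w t i)).
pose U j x := v0 j * \prod_(i | i != j) ((u x - w0 i) / (w0 j - w0 i)).
apply: (@ucvg_sum _ (index_enum 'I_n) xpredT F U) => j _.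
pose f' i t x := (f t x - w t i) / (w t j - w t i).
pose u' i x := (u x - w0 i) / (w0 j - w0 i).
have [||h1 h2] := @ucvg_prod _ (index_enum 'I_n) (fun i => i != j) f' u'.
- move=> i ij; apply: ucvgM.
  + by apply: uboundedB => //; apply: ubounded_cst.
  + exact: ubounded_cst.
  + exact: ucvgB.
  + apply: ucvgV; first by rewrite subr_eq0 (inj_eq winj) eq_sym.
    exact: ucvgB.
- move=> i ij; apply: uboundedM; last exact: ubounded_cst.
  by apply: uboundedB => //; apply: ubounded_cst.
- exact: ucvgM (ubounded_cst _) h2 (vv j) h1.
Qed.

End UniformConvergence.
(** * Metric closeness and closeness of lattice points *)


Lemma expr_unbounded (R : archiRealFieldType) (b x : R) : 1 < b -> exists n, x < b ^+ n.
Proof.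
move=> b1; pose h := b - 1; have h0 : 0 < h by rewrite subr_gt0.
have bE : b = 1 + h by rewrite /h addrC subrK.
have bernoulli n : 1 + h *+ n <= b ^+ n.
  elim: n => [|n IH]; first by rewrite mulr0n addr0.
  apply: (@le_trans _ _ (b * (1 + h *+ n))); last first.
    by rewrite exprS ler_pM2l// (lt_trans ltr01).
  have : 0 <= h * (h *+ n) by rewrite mulr_ge0 ?mulrn_wge0// ltW.
  by rewrite bE mulrS; move: (h *+ n) => u; nra.
have [x0|x0] := ltP x 0; first by exists 0%N; rewrite expr0 (lt_trans x0).
exists (Num.bound (x / h)); apply: lt_le_trans (bernoulli _).
have : x / h < (Num.bound (x / h))%:R by apply: archi_boundP; rewrite divr_ge0// ltW.
by rewrite ltr_pdivrMr// mulr_natl => /lt_trans; apply; rewrite ltrDr.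
Qed.

Section Spreading.
Variables (R : realType) (C : fieldType) (a : absval R C).
Hypothesis complete_a : av_complete a.
Variables (alpha : C) (N : nat).
Hypothesis alpha_gt1 : 1 < a alpha.
Implicit Types (L M : set C) (x y z : C) (e rho : R).
Local Notation expL L := (lattice_exp a L).
Local Notation ball_le rho := [set z | a z <= rho].

(** The bound N on the index of alpha L in L is stated as a pigeonhole principle
    for alpha^-1 L modulo L. *)
Definition stable_lattice L := [/\ discrete_group a L, forall x, L x -> L (alpha * x)
  & forall y : 'I_N.+1 -> C, (forall i, L (alpha * y i)) ->
     exists i j, i != j /\ L (y i - y j)].

Let alpha0 : alpha != 0. Proof. exact: alpha_neq0 alpha_gt1. Qed.

Lemma stable_expB L x y : stable_lattice L -> expL L (x - y) = expL L x - expL L y.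
Proof. by case=> dL _ _; apply: lattice_expB. Qed.

Lemma lattice_exp_eq0 L z : stable_lattice L -> expL L z = 0 -> L z.
Proof.
case=> dL _ _ e0; have [l Ll] := nearest_lattice_point dL complete_a z.
rewrite e0 absv0 => h; rewrite (_ : z = l) //; apply/subr0_eq/(@absv_eq0 _ _ a)/eqP.
by rewrite eq_le h absv_ge0.
Qed.

(** For each radius, the polynomial of [partial_exp_poly] is recovered from its
    values at the N + 1 sample points; then let the radius tend to infinity. *)
Lemma lattice_exp_lagrange L (zeta : 'I_N.+1 -> C) z : stable_lattice L ->
  injective (fun i => expL L (zeta i)) ->
  expL L (alpha * z) = lagrange_value (fun i => expL L (zeta i))
    (fun i => expL L (alpha * zeta i)) (expL L z).
Proof.
move=> sL zinj; case: (sL) => dL aL iL.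
pose P := partial_exp a L.
pose D : set unit := setT.
have cvg1 (c : R) y : 0 < c ->
    ucvg a \oo D (fun n _ => P (c * n%:R) y) (fun _ => expL L y).
  move=> c0 e e0; have [t0 t00 Ht] := partial_exp_cvg dL complete_a y e0.
  have [n0 n0P] : exists n0, t0 / c < n0%:R.
    by exists (Num.bound (t0 / c)); apply: archi_boundP; rewrite divr_ge0// ltW.
  exists n0 => // n /= n0n _ _; apply/ltW/Ht; rewrite mulrC -ler_pdivrMr//.
  by apply: le_trans (ltW n0P) _; rewrite ler_nat.
have cvg0 y : ucvg a \oo D (fun n _ => P n%:R y) (fun _ => expL L y).
  by move=> e /(cvg1 1 y ltr01); apply: filterS => n; rewrite mul1r.
have cvg2 := ucvg_lagrange zinj (ubounded_cst a D (expL L z)) (cvg0 z)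
  (fun i => cvg0 (zeta i))
  (fun i => cvg1 _ (alpha * zeta i) (lt_trans ltr01 alpha_gt1)).
have cvg3 := cvg1 _ (alpha * z) (lt_trans ltr01 alpha_gt1).
apply/subr0_eq/(@absv_eq0 _ _ a)/eqP; rewrite eq_le absv_ge0 andbT.
apply/ler_addgt0Pr => e e0; rewrite add0r.
have [n [/= H2 H3]] := @filter_ex _ \oo _ _ (filterI (cvg2 _ e e0) (cvg3 e e0)).
have [p sp pE] := partial_exp_poly dL alpha_gt1 aL iL (ler0n R n).
have Einj : injective (fun i => P n%:R (zeta i)).
  move=> i j Pij; apply: zinj.
  have : zeta i - zeta j \in lball a L n%:R.
    rewrite -(partial_exp_eq0 dL)// (partial_expB dL)// subr_eq0; exact/eqP.
  move=> /(lballP dL)[Lij _]; apply/subr0_eq; rewrite -stable_expB//.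
  exact: lattice_exp_lattice.
have h2 := H2 tt I; have := H3 tt I.
rewrite /P pE (lagrange_interpolation _ Einj sp).
rewrite (_ : (fun j => p.[_]) = fun j => P (a alpha * n%:R) (alpha * zeta j)); last first.
  by apply: funext => j; rewrite /P pE.
move=> h3; rewrite -(subrKA (lagrange_value (fun i => P n%:R (zeta i))
  (fun i => P (a alpha * n%:R) (alpha * zeta i)) (P n%:R z))).
by apply: absvD_le; last exact: h2; rewrite absv_distC.
Qed.

Lemma lattice_min_norm L : discrete_group a L ->
  exists2 s, 0 < s <= 1 & forall x, L x -> x != 0 -> s <= a x.
Proof.
move=> dL.
have [V0|[v vV]] := fset_0Vmem (lball a L 1 `\ 0)%fset.
  exists 1; first by rewrite ltr01 lexx.
  move=> x Lx x0; rewrite leNgt; apply/negP => x1.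
  have : x \in (lball a L 1 `\ 0)%fset.
    by rewrite in_fsetD1 x0; apply/(lballP dL); split=> //; apply: ltW.
  by rewrite V0 inE.
have [u uV umin] := seq_argmin a vV.
move: (uV); rewrite in_fsetD1 => /andP[u0 /(lballP dL)[Lu u1]].
exists (a u); first by rewrite absv_gt0.
move=> x Lx x0; have [x1|/ltW] := leP (a x) 1; last exact: le_trans.
by apply: umin; rewrite in_fsetD1 x0; apply/(lballP dL).
Qed.

(** Sufficiently high powers of alpha^-1, whose differences are smaller than
    every nonzero element of L. *)
Lemma sample_points L : stable_lattice L -> exists zeta : 'I_N.+1 -> C,
  [/\ injective (fun i => expL L (zeta i)), forall i, a (zeta i) <= 1
    & forall i, a (alpha * zeta i) <= 1].
Proof.
move=> sL; case: (sL) => dL _ _.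
have [s /andP[s0 s1] smin] := lattice_min_norm dL.
have [n0 Hn] := expr_unbounded s^-1 alpha_gt1.
pose zeta (i : 'I_N.+1) := alpha ^- (i + n0).+1.
have az i : a (zeta i) = (a alpha ^+ (i + n0).+1)^-1 by rewrite absvV absvX.
have zs i : a (zeta i) < s.
  rewrite az -[s]invrK ltf_pV2 ?posrE ?invr_gt0 ?exprn_gt0 ?(lt_trans ltr01 alpha_gt1)//.
  by apply: lt_le_trans Hn _; rewrite ler_weXn2l ?(ltW alpha_gt1)// leqW// leq_addl.
exists zeta; split=> [i j eij|i|i].
- have Lij : L (zeta i - zeta j).
    by apply: lattice_exp_eq0 => //; rewrite stable_expB// eij subrr.
  have [e|ne] := eqVneq (zeta i - zeta j) 0.
    have : a (zeta i) = a (zeta j) by rewrite (subr0_eq e).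
    rewrite !az => /invr_inj h; apply/val_inj.
    have [] := ieexprIn (lt_trans ltr01 alpha_gt1) (negbT (gt_eqF alpha_gt1)) h.
    exact: addIn.
  have := smin _ Lij ne; rewrite leNgt => /negP[].
  have [h|h] := leP (a (zeta i)) (a (zeta j)).
    by apply: le_lt_trans (zs j); apply: absvB_le.
  by apply: le_lt_trans (zs i); apply: absvB_le => //; apply: ltW.
- exact: le_trans (ltW (zs i)) s1.
- rewrite absvM az exprS invfM mulrA divff ?mul1r; last by rewrite lt0r_neq0// (lt_trans ltr01 alpha_gt1).
  by rewrite invf_le1 ?exprn_gt0 ?(lt_trans ltr01 alpha_gt1)// exprn_ege1// ltW.
Qed.

Definition close_in_ball rho e L M :=
  (forall l, L l -> a l <= rho -> exists2 m, M m & a (l - m) <= e) /\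
  (forall m, M m -> a m <= rho -> exists2 l, L l & a (l - m) <= e).

Section Convergence.
Variables (T : Type) (G : set_system T) (Lt : T -> set C) (L0 : set C).
Context {FG : Filter G}.
Hypotheses (sLt : forall t : T, stable_lattice (Lt t)) (sL0 : stable_lattice L0).

(** The interpolation formula expresses e(alpha z) by e(z) and the values of e
    at finitely many points of the ball of radius rho, with the same points for
    all lattices near L0. *)
Lemma ucvg_spread rho : 1 <= rho ->
  ucvg a G (ball_le rho) (fun t => expL (Lt t)) (expL L0) ->
  ucvg a G (ball_le (a alpha * rho)) (fun t => expL (Lt t)) (expL L0).
Proof.
move=> rho1 cvgL; have rho0 := lt_le_trans ltr01 rho1.
have [zeta [zinj z1 az1]] := sample_points sL0.
have point y : a y <= 1 ->
    ucvg a G (ball_le rho) (fun t _ => expL (Lt t) y) (fun _ => expL L0 y).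
  by move=> y1 e /cvgL; apply: filterS => t ht x _; apply: ht => /=; apply: le_trans y1 rho1.
have [dL0 _ _] := sL0.
have [M M0 bM] := lattice_exp_bounded dL0 complete_a rho0.
have cvg2 := ucvg_lagrange zinj (ex_intro2 _ _ M M0 bM) cvgL
  (fun i => point _ (z1 i)) (fun i => point _ (az1 i)).
have near_inj : \forall t \near G, injective (fun i => expL (Lt t) (zeta i)).
  have : \forall t \near G, forall ij : 'I_N.+1 * 'I_N.+1, ij.1 != ij.2 ->
      expL (Lt t) (zeta ij.1) != expL (Lt t) (zeta ij.2).
    apply: filter_forall => -[i j] /=.
    have [->|ij] := eqVneq i j; first by near=> t.
    pose d := expL L0 (zeta i) - expL L0 (zeta j).
    have d0 : d != 0 by rewrite subr_eq0 (inj_eq zinj).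
    have ad0 : 0 < a d / 2 by rewrite divr_gt0// absv_gt0.
    apply: filterS (ucvgB (point _ (z1 i)) (point _ (z1 j)) ad0) => t ht _.
    apply/eqP => e; have := ht 0; rewrite /= absv0 e subrr sub0r absvN => /(_ (ltW rho0)).
    by rewrite ler_pdivlMr// mulr_natr mulr2n gerDl leNgt absv_gt0.
  apply: filterS => t ht i j; have := ht (i, j); case: eqVneq => //= _ /(_ isT) /eqP h e.
  by case: h.
move=> e e0; apply: filterS2 near_inj (cvg2 FG e e0) => t tinj ht y /= yrho.
have -> : y = alpha * (y / alpha) by rewrite mulrC mulfVK.
rewrite (lattice_exp_lagrange _ (sLt t) tinj) (lattice_exp_lagrange _ sL0 zinj); apply: ht => /=.
by rewrite absvM absvV ler_pdivrMr ?(lt_trans ltr01 alpha_gt1)// mulrC.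
Unshelve. all: by end_near. Qed.

Lemma ucvg_everywhere rho :
  ucvg a G (ball_le 1) (fun t => expL (Lt t)) (expL L0) ->
  ucvg a G (ball_le rho) (fun t => expL (Lt t)) (expL L0).
Proof.
move=> cvg1; have [n rn] := expr_unbounded rho alpha_gt1.
have : ucvg a G (ball_le (a alpha ^+ n)) (fun t => expL (Lt t)) (expL L0).
  elim: n {rn} => // n IH; rewrite exprS; apply: ucvg_spread => //.
  by rewrite exprn_ege1// ltW.
move=> h e /h; apply: filterS => t ht y /= yr; apply: ht => /=.
exact: le_trans yr (ltW rn).
Qed.

Lemma ucvg_close_in_ball rho e : 0 < e ->
  ucvg a G (ball_le 1) (fun t => expL (Lt t)) (expL L0) ->
  \forall t \near G, close_in_ball rho e L0 (Lt t).
Proof.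
move=> e0 /(ucvg_everywhere rho) /(_ e e0); apply: filterS => t ht.
have [dLt _ _] := sLt t; have [dL0 _ _] := sL0.
split=> [l Ll lr|m Mm mr].
  have [m Mm lm] := nearest_lattice_point dLt complete_a l; exists m => //.
  apply: le_trans lm _; have := ht l lr.
  by rewrite (lattice_exp_lattice dL0 complete_a Ll) subr0.
have [l Ll lm] := nearest_lattice_point dL0 complete_a m; exists l => //.
rewrite absv_distC; apply: le_trans lm _; have := ht m mr.
by rewrite (lattice_exp_lattice dLt complete_a Mm) sub0r absvN.
Qed.

End Convergence.

(** Multiplying a nonzero x by powers of alpha, one reaches a point of M of
    norm greater than d but less than s, which is near a nonzero point of L of
    the same norm. *)
Lemma small_lattice_point L M s d rho : (forall x, L x -> x != 0 -> s <= a x) ->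
  (forall x, M x -> M (alpha * x)) -> a alpha * d < s -> a alpha * d <= rho ->
  close_in_ball rho d L M -> forall x, M x -> a x <= d -> x = 0.
Proof.
move=> smin Malpha ds drho [_ close] x Mx xd; apply/eqP; apply: contraT => x0.
have ax0 := absv_gt0 a x0; have d0 := lt_le_trans ax0 xd.
have Mpow n : M (alpha ^+ n * x).
  by elim: n => [|n IH]; rewrite ?mul1r// exprS -mulrA; apply: Malpha.
have exn : exists n, d < a (alpha ^+ n * x).
  have [n Hn] := expr_unbounded (d / a x) alpha_gt1.
  by exists n; rewrite absvM absvX -ltr_pdivrMr.
case: (ex_minnP exn) => -[|n] big minn.
  by move: big; rewrite mul1r ltNge xd.
have small : a (alpha ^+ n * x) <= d.
  by rewrite leNgt; apply/negP => /minn; rewrite ltnn.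
have le : a (alpha ^+ n.+1 * x) <= a alpha * d.
  by rewrite exprS -mulrA absvM ler_pM2l// (lt_trans ltr01).
have [l Ll lx] := close _ (Mpow n.+1) (le_trans le drho).
have al : a l = a (alpha ^+ n.+1 * x).
  by rewrite -[l](subrK (alpha ^+ n.+1 * x)) addrC absvD_eq// (le_lt_trans lx).
have l0 : l != 0.
  by apply/eqP => l0; move: big; rewrite -al l0 absv0 ltNge (ltW d0).
by have := smin l Ll l0; rewrite al leNgt (le_lt_trans le).
Qed.

(** Here s is the least norm of nonzero points of L, cut off at 1, and B bounds
    the partial products of L on the unit ball. The radius rho makes the tails
    of both products smaller than e, and d is so small that points of L and M
    in the ball correspond bijectively and the finite products are close. *)
Lemma exp_close_of_close_in_ball L e : discrete_group a L -> 0 < e ->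
  exists rho d, 0 < d /\ forall M, discrete_group a M -> (forall x, M x -> M (alpha * x)) ->
    close_in_ball rho d L M -> forall z, a z <= 1 -> a (expL L z - expL M z) <= e.
Proof.
move=> dL e0; have [s /andP[s0 s1] smin] := lattice_min_norm dL.
have aa0 := lt_trans ltr01 alpha_gt1.
have [B B0 bB] := partial_exp_bounded dL ltr01.
pose rho := Num.max (a alpha) ((B + 1) / e).
have rho_a : a alpha <= rho by rewrite le_max lexx.
have rho1 : 1 <= rho by apply: le_trans rho_a; apply: ltW.
have rho0 := lt_le_trans ltr01 rho1.
have rho_e : (B + 1) / rho <= e.
  by rewrite ler_pdivrMr// mulrC -ler_pdivrMr// le_max lexx orbT.
pose V := (lball a L rho `\ 0)%fset.
pose K := s^-1 ^+ size V.
have K0 : 0 < K by rewrite exprn_gt0// invr_gt0.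
pose d := Num.min (s / (2 * a alpha)) (Num.min 1 e * s ^+ 2 / K).
have d0 : 0 < d.
  rewrite lt_min; apply/andP; split; first by rewrite divr_gt0// mulr_gt0.
  by rewrite divr_gt0// mulr_gt0 ?exprn_gt0// lt_min ltr01.
have ads : a alpha * d < s.
  apply: (@le_lt_trans _ _ (a alpha * (s / (2 * a alpha)))).
    by rewrite ler_pM2l// ge_min lexx.
  rewrite [_ * (s / _)](_ : _ = s / 2); last by field; rewrite lt0r_neq0.
  by rewrite ltr_pdivrMr// mulr_natr mulr2n ltrDl.
have ds : d < s by apply: le_lt_trans ads; rewrite ler_peMl ?(ltW d0)// ltW.
have dK : d / s ^+ 2 * K <= Num.min 1 e.
  rewrite -ler_pdivlMr// ler_pdivrMr ?exprn_gt0// mulrAC.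
  by rewrite ge_min lexx orbT.
exists rho, d; split=> // M dM Malpha close z z1.
have adrho : a alpha * d <= rho by apply: le_trans (ltW ads) (le_trans s1 rho1).
have small := small_lattice_point smin Malpha ads adrho close.
have [LM ML] := close; have [L0 LB _] := dL; have [M0 MB _] := dM.
have /choice [b Hb] : forall l, exists m, L l -> a l <= rho -> M m /\ a (l - m) <= d.
  move=> l; have [[Ll lr]|h] := EM (L l /\ a l <= rho); last by exists 0 => ? ?; case: h.
  by have [m Mm lm] := LM l Ll lr; exists m.
have VP l : l \in V -> [/\ L l, a l <= rho, l != 0, s <= a l & a (b l) = a l].
  rewrite in_fsetD1 => /andP[l0 /(lballP dL)[Ll lr]]; have sl := smin l Ll l0; split=> //.
  have [_ lb] := Hb l Ll lr.
  rewrite -[b l](subrK l) addrC absvD_eq// absv_distC (le_lt_trans lb)//.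
  exact: lt_le_trans sl.
have binj : {in V &, injective b}.
  move=> l l' lV lV' e'; have [Ll lr _ _ _] := VP l lV; have [Ll' lr' _ _ _] := VP l' lV'.
  apply/subr0_eq/eqP; apply: contraT => ne.
  have := smin _ (LB _ _ Ll Ll') ne; rewrite leNgt => /negP[].
  apply: le_lt_trans ds; rewrite -(subrKA (b l)).
  apply: absvD_le; first by case: (Hb l Ll lr).
  by rewrite e' absv_distC; case: (Hb l' Ll' lr').
(* If m in M is near l, then m and b l differ by a point of M of norm at most
   d, which is 0 by [small_lattice_point]. *)
have WV : perm_eq (lball a M rho `\ 0)%fset [seq b l | l <- V].
  apply: uniq_perm; rewrite ?fset_uniq ?map_inj_in_uniq ?fset_uniq// => m.
  rewrite in_fsetD1; apply/andP/mapP => [[m0 /(lballP dM)[Mm mr]]|[l lV ->]]; last first.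
    have [Ll lr l0 sl bl] := VP l lV; have [Mb _] := Hb l Ll lr; split.
      by apply: contraTneq s0 => b0; rewrite -leNgt (le_trans sl)// -bl b0 absv0.
    by apply/(lballP dM); rewrite bl.
  have [l Ll lm] := ML m Mm mr.
  have l0 : l != 0.
    by apply: contra_neq m0 => l0; apply: small => //; move: lm; rewrite l0 sub0r absvN.
  have lr : a l <= rho.
    rewrite -[l](subrK m); apply: absvD_le => //; apply: le_trans lm _.
    exact: ltW (lt_le_trans ds (le_trans s1 rho1)).
  have [Mb lb] := Hb l Ll lr.
  exists l; first by rewrite in_fsetD1 l0; apply/(lballP dL).
  apply/subr0_eq/small; first exact: MB.
  rewrite -(subrKA l); apply: absvD_le => //.
  by rewrite absv_distC.
have PM : partial_exp a M rho z = z * \prod_(l <- V) (1 - z / b l).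
  by rewrite /partial_exp (perm_big _ WV) big_map.
have inv_s : 1 <= s^-1 by rewrite invf_ge1.
have factor x : s <= a x -> a (1 - z / x) <= s^-1.
  move=> sx; have ax0 := lt_le_trans s0 sx.
  apply: absvB_le; first by rewrite absv1.
  rewrite absvM absvV -[leRHS]mul1r ler_pM ?absv_ge0 ?invr_ge0 ?absv_ge0//.
  by rewrite lef_pV2.
have PLM : a (partial_exp a M rho z - partial_exp a L rho z) <= Num.min 1 e.
  apply: le_trans dK; rewrite PM /partial_exp -mulrBr absvM -[leRHS]mul1r.
  rewrite ler_pM ?absv_ge0//.
  apply: prod_close => //.
  - by rewrite divr_ge0 ?exprn_ge0 ?ltW.
  - by move=> l /VP[_ _ _ sl bl]; apply: factor; rewrite bl.
  - by move=> l /VP[_ _ _ sl _]; apply: factor.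
  move=> l lV; have [Ll lr l0 sl bl] := VP l lV; have [_ lb] := Hb l Ll lr.
  have al0 := lt_le_trans s0 sl.
  have b0 : b l != 0 by apply: contraTneq al0 => b0; rewrite -bl b0 absv0 ltxx.
  rewrite (_ : _ - _ = z * (b l - l) / (l * b l)); last by field; rewrite b0.
  rewrite absvM absvV !absvM bl ler_pdivrMr ?mulr_gt0//.
  rewrite mulrAC ler_pdivlMr ?exprn_gt0// absv_distC.
  apply: (@le_trans _ _ (1 * d * s ^+ 2)).
    by rewrite ler_wpM2r ?exprn_ge0 ?(ltW s0)// ler_pM ?absv_ge0.
  by rewrite mul1r ler_wpM2l ?(ltW d0)// -expr2 lerXn2r ?nnegrE ?(ltW s0) ?absv_ge0.
have BL : a (partial_exp a L rho z) <= B + 1.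
  by apply: le_trans (bB z rho z1 rho1) _; rewrite lerDl.
have BM : a (partial_exp a M rho z) <= B + 1.
  rewrite -[X in a X](subrK (partial_exp a L rho z)); apply: absvD_le => //.
  by apply: le_trans PLM _; rewrite ge_min lerDr B0.
have tail M' : discrete_group a M' -> a (partial_exp a M' rho z) <= B + 1 ->
    a (expL M' z - partial_exp a M' rho z) <= e.
  move=> dM' b'; apply: le_trans (lattice_exp_close dM' complete_a rho0 (le_trans z1 rho1)) _.
  apply: le_trans rho_e; rewrite ler_pM ?absv_ge0 ?divr_ge0 ?absv_ge0 ?(ltW rho0)//.
  by rewrite -[leRHS]mul1r ler_wpM2r// invr_ge0 ltW.
rewrite (_ : _ - _ = (expL L z - partial_exp a L rho z)
   - (partial_exp a M rho z - partial_exp a L rho z)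
   - (expL M z - partial_exp a M rho z)); last by ring.
apply: absvB_le; last exact: tail.
apply: absvB_le; first exact: tail.
by apply: le_trans PLM _; rewrite ge_min lexx orbT.
Qed.

End Spreading.

(** * The action of an invertible ideal on lattices *)

Section ModuleSpans.
Variables (F C : fieldType) (phi : {rmorphism F -> C}).
Implicit Types (D : set F) (S X : set C).

Lemma mod_span0 D S : mod_span phi D S 0.
Proof. by exists 0%N, (fun=> 0), (fun=> 0); split; [case|case|rewrite big_ord0]. Qed.

Lemma mod_span_gen D S d s : D d -> S s -> mod_span phi D S (phi d * s).
Proof. by move=> Dd Ss; exists 1%N, (fun=> d), (fun=> s); split=> //; rewrite big_ord1. Qed.

Lemma mod_spanD D S x y : mod_span phi D S x -> mod_span phi D S y -> mod_span phi D S (x + y).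
Proof.
move=> [n [d [s [Dd Ss ->]]]] [n' [d' [s' [Dd' Ss' ->]]]].
exists (n + n')%N, (fun i => match fintype.split i with inl j => d j | inr j => d' j end).
exists (fun i => match fintype.split i with inl j => s j | inr j => s' j end); split.
- by move=> i; case: (fintype.split i).
- by move=> i; case: (fintype.split i).
rewrite big_split_ord; congr (_ + _); apply: eq_bigr => i _.
  by rewrite (unsplitK (inl i)).
by rewrite (unsplitK (inr i)).
Qed.

Lemma mod_span_ind D S X : X 0 -> (forall x y, X x -> X y -> X (x + y)) ->
  (forall d s, D d -> S s -> X (phi d * s)) -> mod_span phi D S `<=` X.
Proof.
move=> X0 XD Xg _ [n [d [s [Dd Ss ->]]]].
by apply: (big_ind X) => // i _; apply: Xg.
Qed.

Lemma mod_span_sum D S (I : eqType) (r : seq I) (f : I -> C) :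
  (forall i, i \in r -> mod_span phi D S (f i)) -> mod_span phi D S (\sum_(i <- r) f i).
Proof.
move=> h; rewrite big_seq; apply: (big_ind (mod_span phi D S)) => //.
  exact: mod_span0.
by move=> x y; apply: mod_spanD.
Qed.

End ModuleSpans.

Section IdealAction.
Variables (R : realType) (F C : fieldType) (phi : {rmorphism F -> C}) (a : absval R C).
Variable A : set F.
Hypotheses (AM : forall x y, A x -> A y -> A (x * y)) (AN1 : A (-1)).
Implicit Types (J G : set F) (L M : set C).

Definition submodule L := [/\ L 0, forall x y, L x -> L y -> L (x + y)
  & forall c x, A c -> L x -> L (phi c * x)].

(** For a fractional ideal J of A with inverse G, this says that J is invertible;
    it is symmetric in J and G, so that one argument serves both the action
    and its inverse. *)
Definition dual J G := (forall x y, J x -> G y -> A (x * y)) /\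
  exists2 l : seq (F * F), forall p, p \in l -> J p.1 /\ G p.2 &
    \sum_(p <- l) p.1 * p.2 = 1.

Lemma dualC J G : dual J G -> dual G J.
Proof.
move=> [JG [l lJG lE]]; split=> [x y Gx Jy|]; first by rewrite mulrC; apply: JG.
exists [seq (p.2, p.1) | p <- l]; first by move=> _ /mapP[p /lJG[] ? ? ->].
by rewrite big_map -lE; apply: eq_bigr => p _; rewrite mulrC.
Qed.

Lemma dual_neq0 J G : dual J G -> exists2 j, J j & j != 0.
Proof.
move=> [_ [l lJG lE]]; apply: contrapT => h.
suff : (1 : F) = 0 by move/eqP; rewrite oner_eq0.
rewrite -lE big_seq big1// => p /lJG[Jp _].
rewrite (_ : p.1 = 0) ?mul0r//; apply/eqP; apply: contraPT h => p0; apply.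
by exists p.1.
Qed.

Lemma submodule_sum L (I : Type) (r : seq I) (P : pred I) (f : I -> C) : submodule L ->
  (forall i, P i -> L (f i)) -> L (\sum_(i <- r | P i) f i).
Proof. by move=> [L0 LD _] h; apply: (big_ind L). Qed.

(** If J z is contained in L, then z is the sum of the g (j z). *)
Lemma mod_span_dualE J G L z : dual J G -> submodule L ->
  mod_span phi G L z <-> forall j, J j -> L (phi j * z).
Proof.
move=> [JG [l lJG lE]] sL; case: (sL) => L0 LD LM; split=> [|h].
  have := @mod_span_ind _ _ phi G L [set z | forall j, J j -> L (phi j * z)].
  apply=> [j _|x y Lx Ly j Jj|d s Gd Ls j Jj]; first by rewrite mulr0.
    by rewrite mulrDr; apply: LD; [apply: Lx|apply: Ly].
  by rewrite mulrA -rmorphM; apply: LM => //; apply: JG.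
have -> : z = \sum_(p <- l) phi p.2 * (phi p.1 * z).
  under eq_bigr do rewrite mulrA -rmorphM mulrC.
  by rewrite -mulr_sumr -rmorph_sum; under eq_bigr do rewrite mulrC; rewrite lE rmorph1 mulr1.
apply: mod_span_sum => p /lJG[Jp Gp]; apply: mod_span_gen => //; exact: h.
Qed.

Lemma mod_span_dual_submodule J G L : dual J G -> submodule L -> submodule (mod_span phi G L).
Proof.
move=> dJG sL; case: (sL) => L0 LD LM; split; first exact: mod_span0.
  by move=> x y; apply: mod_spanD.
move=> c x Ac /(mod_span_dualE _ dJG sL) h; apply/(mod_span_dualE _ dJG sL) => j Jj.
by rewrite mulrCA; apply: LM => //; apply: h.
Qed.

Lemma mod_span_dualK J G L : dual J G -> submodule L ->
  mod_span phi J (mod_span phi G L) = L.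
Proof.
move=> dJG sL; have sGL := mod_span_dual_submodule dJG sL.
case: (sL) => L0 LD LM; case: (dJG) => JG [l lJG lE].
apply/seteqP; split=> z.
  move=> /(mod_span_dualE _ (dualC dJG) sGL) h.
  have -> : z = \sum_(p <- l) phi p.1 * (phi p.2 * z).
    by under eq_bigr do rewrite mulrA -rmorphM; rewrite -mulr_suml -rmorph_sum lE rmorph1 mul1r.
  rewrite big_seq; apply: submodule_sum => // p /lJG[Jp Gp].
  by have /(mod_span_dualE _ dJG sL) := h _ Gp; apply.
move=> Lz; apply/(mod_span_dualE _ (dualC dJG) sGL) => g Gg.
apply/(mod_span_dualE _ dJG sL) => j Jj; rewrite mulrA -rmorphM.
by apply: LM => //; apply: JG.
Qed.

Variable r : nat.
Local Notation lat := (lattice A phi a r).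

Lemma lattice_submodule (L : lat) : submodule L.
Proof.
have [n [g ->]] := lattice_fg L; split; first exact: mod_span0.
  by move=> x y; apply: mod_spanD.
move=> c x Ac; have := @mod_span_ind _ _ phi A (range g)
  [set x | mod_span phi A (range g) (phi c * x)].
apply=> [|u v hu hv|d s Ad gs] /=; first by rewrite mulr0; apply: mod_span0.
  by rewrite mulrDr; apply: mod_spanD.
by rewrite mulrA -rmorphM; apply: mod_span_gen => //; apply: AM.
Qed.

Lemma lattice_discrete_group (L : lat) : discrete_group a L.
Proof.
have [L0 LD LM] := lattice_submodule L; split=> //; last exact: lattice_discrete.
by move=> x y Lx Ly; apply: LD => //; rewrite -mulN1r -(rmorphN1 phi); apply: LM.
Qed.

Lemma lattice_eq (L M : lat) : lattice_set L = lattice_set M -> L = M.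
Proof.
case: L => L l1 l2 l3; case: M => M m1 m2 m3 /= LM; case: M / LM m1 m2 m3 => m1 m2 m3.
by congr Lattice; apply: Prop_irrelevance.
Qed.

(** Generators of G L are the products of the g with generators of L. The other
    two properties follow from j (G L) being contained in L and g L in G L,
    for nonzero j in J and g in G. *)
Lemma lattice_action J G (L : lat) : dual J G ->
  exists M : lat, lattice_set M = mod_span phi G L.
Proof.
move=> dJG; case: (dJG) => JG [l lJG lE]; have sL := lattice_submodule L.
have fg : exists n (g : 'I_n -> C), mod_span phi G L = mod_span phi A (range g).
  have [n [g0 LE]] := lattice_fg L.
  pose T := ('I_(size l) * 'I_n)%type.
  pose gam (t : T) := phi (l`_t.1).2 * g0 t.2.
  have gamR t : range (fun i : 'I_#|{: T}| => gam (enum_val i)) (gam t).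
    by exists (enum_rank t) => //; rewrite enum_rankK.
  exists #|{: T}|, (fun i => gam (enum_val i)); apply/seteqP; split=> z.
    move=> /(mod_span_dualE _ dJG sL) h.
    have -> : z = \sum_(p <- l) phi p.2 * (phi p.1 * z).
      under eq_bigr do rewrite mulrA -rmorphM mulrC.
      by rewrite -mulr_sumr -rmorph_sum; under eq_bigr do rewrite mulrC; rewrite lE rmorph1 mulr1.
    apply: mod_span_sum => p pl; have [Jp _] := lJG p pl.
    have := h _ Jp; rewrite LE; move: (phi p.1 * z).
    apply: (@mod_span_ind _ _ phi A (range g0) [set x | mod_span phi A _ (phi p.2 * x)]).
    - by rewrite /= mulr0; apply: mod_span0.
    - by move=> x y /= hx hy; rewrite mulrDr; apply: mod_spanD.
    - move=> c _ Ac [i _ <-] /=; rewrite mulrCA; apply: mod_span_gen => //.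
      have pi : (index p l < size l)%N by rewrite index_mem.
      have := gamR (Ordinal pi, i); rewrite /gam /= nth_index//.
  move=> hz; apply/(mod_span_dualE _ dJG sL); move: z hz.
  apply: mod_span_ind.
  - by move=> j _; rewrite mulr0; case: sL.
  - by move=> x y hx hy j Jj; rewrite mulrDr; case: sL => _ LD _; apply: LD; [apply: hx|apply: hy].
  - move=> c _ Ac [i _ <-] j Jj; rewrite /gam.
    set p := l`_ _; have [_ Gp] : J p.1 /\ G p.2 by apply: lJG; apply: mem_nth.
    rewrite mulrA -rmorphM mulrA -rmorphM mulrAC; case: sL => _ _ LM; rewrite LE.
    by apply: mod_span_gen; [apply: AM => //; apply: JG|exists (enum_val i).2].
have dis t : finite_set (mod_span phi G L `&` [set z | a z <= t]).
  have [j Jj j0] := dual_neq0 dJG.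
  have pj0 : phi j != 0 by rewrite fmorph_eq0.
  apply: (sub_finite_set _ (finite_image (fun x => (phi j)^-1 * x)
    (@lattice_discrete _ _ _ _ _ _ _ L (a (phi j) * t)))).
  move=> z [/(mod_span_dualE _ dJG sL) h /= zt]; exists (phi j * z); last by rewrite mulKf.
  by split; [apply: h|rewrite /= absvM ler_wpM2l ?absv_ge0].
have rk : exists2 n, (n <= r)%N & has_rank phi (mod_span phi G L) n.
  have [n nr [b [bind bE]]] := lattice_rank L; exists n => //; exists b; split=> //.
  rewrite -bE; apply/seteqP; split.
    apply: mod_span_ind; first exact: mod_span0.
      by move=> x y; apply: mod_spanD.
    move=> c x _; move: x; apply: mod_span_ind => [|x y|d s _ Ls].
    - by rewrite mulr0; apply: mod_span0.
    - by rewrite mulrDr; apply: mod_spanD.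
    - by rewrite mulrA -rmorphM; apply: mod_span_gen.
  apply: mod_span_ind; first exact: mod_span0.
    by move=> x y; apply: mod_spanD.
  have [g Gg g0] := dual_neq0 (dualC dJG).
  move=> c x _ Lx; rewrite -(mulfVK g0 c) rmorphM -mulrA.
  by apply: mod_span_gen => //; apply: mod_span_gen.
by exists (Lattice fg dis rk).
Qed.

(** The constant B bounds the |j| and |g| in a fixed expression of 1 as a sum of
    products j g. Given z, replace the points j z of L by nearby points of M in
    the expression of z as the sum of the g (j z). *)
Lemma close_points_mod_span J G : dual J G -> exists2 B : R, 0 < B &
  forall L M rho e, submodule L -> submodule M -> 0 <= e ->
  (forall l, L l -> a l <= B * rho -> exists2 m, M m & a (l - m) <= e) ->
  forall z, mod_span phi G L z -> a z <= rho ->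
    exists2 m, mod_span phi G M m & a (z - m) <= B * e.
Proof.
move=> dJG; case: (dJG) => JG [l lJG lE].
pose B : R := 1 + \sum_(p <- l) (a (phi p.1) + a (phi p.2)).
have B0 : 0 < B.
  by rewrite ltr_wpDr// sumr_ge0// => p _; rewrite addr_ge0 ?absv_ge0.
have Bp p : p \in l -> a (phi p.1) <= B /\ a (phi p.2) <= B.
  move=> pl; rewrite /B (big_rem p pl) /=; set s := \sum_(_ <- _) _.
  have s0 : 0 <= s by rewrite sumr_ge0// => q _; rewrite addr_ge0 ?absv_ge0.
  by have := absv_ge0 a (phi p.1); have := absv_ge0 a (phi p.2); split; lra.
exists B => // L M rho e sL sM e0 close z /(mod_span_dualE _ dJG sL) hz zr.
have /choice [m Hm] : forall p : F * F, exists m, p \in l ->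
    M m /\ a (phi p.1 * z - m) <= e.
  move=> p; have [pl|_] := boolP (p \in l); last by exists 0.
  have [Jp _] := lJG p pl; have pz : a (phi p.1 * z) <= B * rho.
    by rewrite absvM ler_pM ?absv_ge0//; case: (Bp p pl).
  by have [m Mm pm] := close _ (hz _ Jp) pz; exists m.
exists (\sum_(p <- l) phi p.2 * m p).
  by apply: mod_span_sum => p pl; apply: mod_span_gen; [case: (lJG p pl)|case: (Hm p pl)].
have -> : z - \sum_(p <- l) phi p.2 * m p = \sum_(p <- l) phi p.2 * (phi p.1 * z - m p).
  under [RHS]eq_bigr do rewrite mulrBr mulrA -rmorphM mulrC.
  rewrite sumrB -mulr_sumr -rmorph_sum; congr (_ - _).
  by under eq_bigr do rewrite mulrC; rewrite lE rmorph1 mulr1.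
rewrite big_seq; apply: absv_sum_le => [|p pl]; first by rewrite mulr_ge0// ltW.
rewrite absvM ler_pM ?absv_ge0//; first by case: (Bp p pl).
by case: (Hm p pl).
Qed.

Hypothesis complete_a : av_complete a.
Variables (alpha : F) (N : nat).
Hypotheses (Aalpha : A alpha) (alpha_gt1 : 1 < a (phi alpha)).
Hypothesis stable : forall L : lat, stable_lattice a (phi alpha) N L.

Lemma lattice_exp_ucvg (L0 : lat) :
  ucvg a (nbhs L0) [set z | a z <= 1] (fun L : lat => lattice_exp a L) (lattice_exp a L0).
Proof.
move=> e e0; apply/nbhs_latticeP; exists e => // L dL z /= z1.
rewrite absv_distC -lee_fin; apply: le_trans (ltW dL).
by apply: ereal_sup_ubound; exists z.
Qed.

Lemma ideal_action_continuous J G (f : lat -> lat) : dual J G ->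
  (forall L : lat, lattice_set (f L) = mod_span phi G L) -> continuous f.
Proof.
move=> dJG fE L0; move=> U /nbhs_latticeP [e e0 Ue].
have e20 : 0 < e / 2 by rewrite divr_gt0.
have [rho [d [d0 close]]] := exp_close_of_close_in_ball complete_a alpha_gt1
  (lattice_discrete_group (f L0)) e20.
have [B B0 HB] := close_points_mod_span dJG.
have dB0 : 0 < d / B by rewrite divr_gt0.
have near_close := ucvg_close_in_ball complete_a alpha_gt1 stable (stable L0) (B * rho) dB0
  (lattice_exp_ucvg L0).
apply: filterS (near_close _) => L [close1 close2]; apply: Ue.
have sL0 := lattice_submodule L0; have sL := lattice_submodule L.
have sfL := lattice_submodule (f L).
have BdB : B * (d / B) = d by rewrite mulrC mulfVK// lt0r_neq0.
apply: (@le_lt_trans _ _ (e / 2)%:E); last first.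
  by rewrite lte_fin ltr_pdivrMr// mulr_natr mulr2n ltrDl.
apply: ge_ereal_sup => _ [z /= z1 <-]; rewrite lee_fin; apply: close => //.
- exact: lattice_discrete_group.
- by move=> x; case: sfL => _ _; apply.
split=> [l|m]; rewrite !fE.
  by move=> Gl lr; have [m Gm lm] := HB L0 L rho _ sL0 sL (ltW dB0) close1 l Gl lr; rewrite BdB in lm; exists m.
move=> Gm mr; have [|l Gl lm] := HB L L0 rho _ sL sL0 (ltW dB0) _ m Gm mr.
  by move=> x Lx xr; have [y Ly xy] := close2 x Lx xr; exists y; rewrite // absv_distC.
by rewrite BdB in lm; exists l; rewrite // absv_distC.
Qed.

Lemma ideal_action_homeomorphism J G : dual J G -> exists f : lat -> lat,
  (forall L : lat, lattice_set (f L) = mod_span phi G L) /\ homeomorphism f.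
Proof.
move=> dJG; have dGJ := dualC dJG.
have /choice [f fE] := fun L : lat => lattice_action L dJG.
have /choice [g gE] := fun L : lat => lattice_action L dGJ.
exists f; split=> //; split; first exact: ideal_action_continuous dJG fE.
exists g; split; last exact: ideal_action_continuous dGJ gE.
  by move=> L; apply: lattice_eq; rewrite gE fE mod_span_dualK//; apply: lattice_submodule.
by move=> L; apply: lattice_eq; rewrite fE gE mod_span_dualK//; apply: lattice_submodule.
Qed.

End IdealAction.

(** A space of dimension d over the finite field k has q^d elements, and d is
    determined by alpha and the bound on the rank. *)
Lemma lattice_index (R : realType) (k : finFieldType) (F : fieldExtType {fraction {poly k}})
    (infty : place F) (C : fieldType) (phi : {rmorphism F -> C}) (a : absval R C)
    (r : nat) (alpha : F) : alpha != 0 -> regular_away infty alpha ->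
  exists N, forall L : lattice (regular_away infty) phi a r,
    stable_lattice a (phi alpha) N L.
Proof.
move=> alpha0 Aalpha; have [d Hd] := module_quotient_kdep phi r alpha0.
exists #|{ffun 'I_d -> k}| => Lat; pose L : set C := Lat; rewrite -/L.
have sL : submodule phi (regular_away infty) L.
  by apply: lattice_submodule; exact: regularM.
have [L0 LD LM] := sL.
have Lalpha x : L x -> L (phi alpha * x) by apply: LM.
split=> //.
  by apply: lattice_discrete_group; [exact: regularM|exact: regularN1].
move=> y Ly.
have ksL : ksub (phi \o @const_in k F) L.
  by split=> // c x Lx; apply: LM => //; apply: regular_const.
have [n nr [b [_ bE]]] := lattice_rank Lat.
pose b' (j : nat) := if insub j is Some i then b i else 0.
have spanL x : L x -> exists c : nat -> F, x = \sum_(j < r) phi (c j) * b' j.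
  move=> Lx; have : mod_span phi setT L x by rewrite -[x]mul1r -(rmorph1 phi); apply: mod_span_gen.
  rewrite bE; move: x {Lx}; apply: mod_span_ind.
  - by exists (fun=> 0); rewrite big1// => j _; rewrite rmorph0 mul0r.
  - move=> _ _ [c1 ->] [c2 ->]; exists (fun j => c1 j + c2 j).
    by rewrite -big_split; apply: eq_bigr => j _; rewrite rmorphD mulrDl.
  - move=> c _ _ [i _ <-]; exists (fun j => if j == i :> nat then c else 0).
    have ir : (i < r)%N by apply: leq_trans nr.
    rewrite (bigD1 (Ordinal ir)) //= eqxx {1}/b' valK big1 ?addr0// => j ji.
    by rewrite -val_eqE /= in ji; rewrite (negPf ji) rmorph0 mul0r.
have dep := Hd L b' ksL Lalpha spanL.
have ks' := ksub_scaled (phi alpha) ksL.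
have [s _ reps] := kspan_finite_reps ksL (kdep_kspan ksL ks' dep).
have /choice [t Ht] : forall i, exists t, scaled (phi alpha) L (phi alpha * y i - s t).
  by move=> i; apply: reps.
have [i [j [ij tij]]] : exists i j, i != j /\ t i = t j.
  apply: contrapT => h; have : injective t.
    by move=> i j tij; apply/eqP; apply: contraPT h => ij; apply; exists i, j.
  by move=> /leq_card; rewrite card_ord ltnn.
exists i, j; split=> //.
have [u Lu iu] := Ht i; have [v Lv jv] := Ht j.
have pa0 : phi alpha != 0 by rewrite fmorph_eq0.
rewrite (_ : y i - y j = u - v); first exact: (ksubB ksL).
by apply: (mulfI pa0); rewrite !mulrBr -iu -jv tij opprB addrA subrK.
Qed.

(** * The homeomorphism *)

Lemma place_degree_gt0 (k : finFieldType) (F : fieldExtType {fraction {poly k}})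
  (v : place F) (d : nat) : place_degree v d -> (0 < d)%N.
Proof.
case: d => // -[b [_ _ span]].
have [c] := span 1 (vge1 v).
rewrite big_ord0 subr0 => -[/eqP|]; first by rewrite oner_eq0.
by rewrite place1.
Qed.

Theorem proposition61 (R : realType)
  (k : finFieldType) (F : fieldExtType {fraction {poly k}})
  (hk : is_constant_field F)
  (infty : place F) (delta : nat) (hdelta : place_degree infty delta)
  (Finf : fieldType) (absFinf : absval R Finf) (i1 : {rmorphism F -> Finf})
  (hFinf : is_completion (place_abs R #|k| delta infty) absFinf i1)
  (Fbar : closedFieldType) (absFbar : absval R Fbar)
  (i2 : {rmorphism Finf -> Fbar})
  (hFbar : is_algebraic_closure absFinf absFbar i2)
  (Cinf : fieldType) (absC : absval R Cinf) (i3 : {rmorphism Fbar -> Cinf})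
  (hC : is_completion absFbar absC i3)
  (r : nat) (hr : (1 <= r)%N)
  (J : set F) (hJ : nonzero_fractional_ideal (regular_away infty) J) :
  exists f : lattice (regular_away infty) (i3 \o i2 \o i1) absC r ->
             lattice (regular_away infty) (i3 \o i2 \o i1) absC r,
    (forall L, lattice_set (f L) =
       ideal_act (regular_away infty) (i3 \o i2 \o i1) J (lattice_set L)) /\
    homeomorphism f.
Proof.
pose phi : {rmorphism F -> Cinf} := i3 \o i2 \o i1.
have [alpha Aalpha valpha] := exists_pole infty.
have alpha0 := place_lt0_neq0 valpha.
have alpha_gt1 : 1 < absC (phi alpha).
  case: hC hFbar hFinf => e3 _ _ [_ e2] [e1 _ _].
  rewrite /phi /= e3 e2 e1 /place_abs (negPf alpha0).
  have q1 : 1 < #|k|%:R ^+ delta :> R.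
    by rewrite exprn_egt1 ?ltr1n ?finNzRing_gt1// -lt0n (place_degree_gt0 hdelta).
  move: valpha; rewrite -oppr_gt0; case: (- infty alpha) => // n n0.
  by rewrite -exprnP exprn_egt1// -lt0n.
have [N stable] := lattice_index phi absC r alpha0 Aalpha.
have dualJ : dual (regular_away infty) J (ideal_inv (regular_away infty) J).
  have [l [lJ lE]] := fractional_ideal_invertible hJ.
  by split; [move=> x y Jx Gy; rewrite mulrC; apply: Gy|exists l].
have [_ _ complete_C] := hC.
exact: (ideal_action_homeomorphism (@regularM _ _ infty) (@regularN1 _ _ infty)
  complete_C Aalpha alpha_gt1 stable dualJ).
Qed.
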